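(* Suppose there exist a continuously differentiable function $V:\mathbb{R}^{2n+q}\to\mathbb{R}$, positive reals $k,c_1,c_2,c_3$, and a neighborhood $\mathcal{U}\subset\mathbb{R}^{2n}$ of $0$ such that $c_1|x|_{\mathcal{A}}^k\le V(x)\le c_2|x|_{\mathcal{A}}^k$ for all $x\in\mathcal{C}$; $\langle\nabla V(x),f(x)\rangle\le-c_3V(x)$ for all $x\in\mathcal{U}\times\mathcal{T}$; and $V(g)-V(x)\le0$ for all $x\in\mathcal{D}$, $g\in G(x)$. Then the set $\mathcal{A}$ is exponentially stable for $\mathcal{H}_{cl}$. Moreover, the basin of attraction of $\mathcal{A}$ contains every sublevel set $\{x\in\mathcal{C}:V(x)\le c\}$ of the restriction of $V$ to $\mathcal{C}$ that is included in $\mathcal{U}\times\mathcal{T}$.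
   Context: Setting: integers $n,m\ge1$, $1\le q\le n$, $n_1,\dots,n_q\ge1$ with $\sum n_i=n$; $\mathcal{N}=\{1,\dots,q\}$; $A\in\mathbb{R}^{n\times n}$, $B\in\mathbb{R}^{n\times m}$, $K\in\mathbb{R}^{m\times n}$, $\bar u\in\mathbb{R}^m$ with $\bar u_i>0$; positive reals $T_1^{(i)}\le T_2^{(i)}$. $\mathfrak{sat}_{\bar u}(v)=(\operatorname{sat}_1(v_1),\dots,\operatorname{sat}_m(v_m))$, $\operatorname{sat}_i(s)=\min(|s|,\bar u_i)\operatorname{sign}(s)$, $\mathfrak{dz}_{\bar u}(y)=\mathfrak{sat}_{\bar u}(y)-y$; $A_{cl}=\begin{bmatrix}A+BK&-BK\\0&A\end{bmatrix}$, $B_{cl}=\begin{bmatrix}B\\0\end{bmatrix}$, $K_{cl}=[K\ \ -K]$. State $x=(x_p,\tilde\eta,\tau)\in\mathbb{R}^n\times\mathbb{R}^n\times\mathbb{R}^q$, $\bar x=(x_p,\tilde\eta)$, $\tilde\eta=(\tilde\eta^{(1)},\dots,\tilde\eta^{(q)})$, $\tilde\eta^{(i)}\in\mathbb{R}^{n_i}$; $\mathcal{T}=\prod_i[0,T_2^{(i)}]$. $\mathcal{H}_{cl}$: $\dot x=f(x)$ on $\mathcal{C}=\mathbb{R}^{2n}\times\mathcal{T}$ with $f(x)=(A_{cl}\bar x+B_{cl}\mathfrak{dz}_{\bar u}(K_{cl}\bar x),-\mathbf{1}_q)$; $x^+\in G(x)$ on $\mathcal{D}=\mathbb{R}^{2n}\times\bigcup_i\mathcal{D}_i$,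 $\mathcal{D}_i=\{\tau\in\mathcal{T}:\tau_i=0\}$, $G(x)=\bigcup_{i:\tau\in\mathcal{D}_i}\{x_p\}\times\{h_i(\tilde\eta)\}\times\widehat{\mathcal{G}}_i(\tau)$, where $h_i(\tilde\eta)$ replaces the block $\tilde\eta^{(i)}$ by $0$ and keeps the others, and $\widehat{\mathcal{G}}_i(\tau)=\{\chi\in\mathbb{R}^q:\chi_i\in[T_1^{(i)},T_2^{(i)}],\chi_k=\tau_k\ \forall k\ne i\}$. Solutions in the sense of Goebel–Sanfelice–Teel. $\mathcal{A}=\{0\}\times\mathcal{T}\subset\mathbb{R}^{2n}\times\mathbb{R}^q$, $|x|_{\mathcal{A}}$ distance to $\mathcal{A}$. $\mathcal{A}$ is exponentially stable if there exist $\kappa,\lambda,\mu>0$ such that every maximal solution $\phi$ with $|\phi(0,0)|_{\mathcal{A}}\le\mu$ is complete and $|\phi(t,j)|_{\mathcal{A}}\le\kappa e^{-\lambda(t+j)}|\phi(0,0)|_{\mathcal{A}}$ for all $(t,j)\in\operatorname{dom}\phi$; the basin of attraction is the set of points from which every maximal solution is complete and converges to $\mathcal{A}$. *)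

(* Defs.v *)
From HB Require Import structures.
From mathcomp Require Import all_boot all_order all_algebra.
From mathcomp Require Import all_classical all_reals all_analysis.
Set Implicit Arguments. Unset Strict Implicit. Unset Printing Implicit Defensive.
Import Order.TTheory GRing.Theory Num.Theory numFieldNormedType.Exports.
Local Open Scope classical_set_scope.
Local Open Scope ring_scope.

Section HybridGeneric.
Variables (R : realType) (N : nat).

(* E is a hybrid time domain: for every (T,J) in E, the truncation
   E ∩ ([0,T] x {0..J}) is a compact hybrid time domain
   ∪_{j=0}^{J} [t_j, t_{j+1}] x {j} with 0 = t_0 <= t_1 <= ... <= t_{J+1}. *)
Definition hybrid_time_domain (E : set (R * nat)) : Prop :=
  forall (T : R) (J : nat), E (T, J) ->
    exists t : nat -> R,
      [/\ t 0%N = 0,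
          (forall j, (j <= J)%N -> t j <= t j.+1) &
          (forall (s : R) (k : nat),
              (E (s, k) /\ s <= T /\ (k <= J)%N) <->
              ((k <= J)%N /\ t k <= s /\ s <= t k.+1))].

Definition abs_cont_on (g : R -> 'cV[R]_N) (a b : R) : Prop :=
  forall e : R, 0 < e -> exists2 d : R, 0 < d &
    forall (K : nat) (u v : nat -> R),
      (forall k, (k < K)%N -> a <= u k /\ u k <= v k /\ v k <= b) ->
      (forall k l, (k < K)%N -> (l < K)%N -> k <> l ->
                   v k <= u l \/ v l <= u k) ->
      \sum_(k < K) (v k - u k) < d ->
      \sum_(k < K) `|g (v k) - g (u k)| < e.

Definition loc_abs_cont_on (g : R -> 'cV[R]_N) (I : set R) : Prop :=
  forall a b, I a -> I b -> a <= b -> abs_cont_on g a b.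

Definition hybrid_arc (dom : set (R * nat)) (phi : R -> nat -> 'cV[R]_N) : Prop :=
  [/\ hybrid_time_domain dom, dom (0, 0%N) &
      forall j, loc_abs_cont_on (fun t => phi t j) [set t | dom (t, j)]].

Definition is_solution (C : set 'cV[R]_N) (f : 'cV[R]_N -> 'cV[R]_N)
    (D : set 'cV[R]_N) (G : 'cV[R]_N -> set 'cV[R]_N)
    (dom : set (R * nat)) (phi : R -> nat -> 'cV[R]_N) : Prop :=
  [/\ hybrid_arc dom phi,
      (* (S0) *) closure C (phi 0 0%N) \/ D (phi 0 0%N),
      (forall j,
         (forall t, interior [set s | dom (s, j)] t -> C (phi t j)) /\
         (\forall t \ae (@lebesgue_measure R),
             [set s | dom (s, j)] t ->
             is_derive t (1 : R) (fun s => phi s j) (f (phi t j)))) &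
      (forall (t : R) (j : nat), dom (t, j) -> dom (t, j.+1) ->
         D (phi t j) /\ G (phi t j) (phi t j.+1))].

Definition maximal_solution C f D G dom phi : Prop :=
  is_solution C f D G dom phi /\
  forall dom' phi', is_solution C f D G dom' phi' -> dom `<=` dom' ->
    (forall t j, dom (t, j) -> phi' t j = phi t j) -> dom' = dom.

Definition complete_dom (dom : set (R * nat)) : Prop :=
  forall M : R, exists t j, dom (t, j) /\ M < t + j%:R.

(* exponential stability of a set, with distance function dist = |.|_A *)
Definition exp_stable C f D G (dist : 'cV[R]_N -> R) : Prop :=
  exists kappa lambda mu : R, [/\ 0 < kappa, 0 < lambda, 0 < mu &
    forall dom phi, maximal_solution C f D G dom phi ->
      dist (phi 0 0%N) <= mu ->
      complete_dom dom /\
      forall t j, dom (t, j) ->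
        dist (phi t j) <= kappa * expR (- lambda * (t + j%:R)) * dist (phi 0 0%N)].

Definition basin C f D G (dist : 'cV[R]_N -> R) : set 'cV[R]_N :=
  [set x | forall dom phi, maximal_solution C f D G dom phi -> phi 0 0%N = x ->
     complete_dom dom /\
     (forall e : R, 0 < e -> exists M : R,
        forall t j, dom (t, j) -> M <= t + j%:R -> dist (phi t j) <= e)].

Definition C1 (V : 'cV[R]_N -> R) : Prop :=
  (forall x, differentiable V x) /\ (forall v, continuous (fun x => 'd V x v)).

Definition eucl (v : 'cV[R]_N) : R := Num.sqrt (\sum_(i < N) v i 0 ^+ 2).
Definition dist_set (S : set 'cV[R]_N) (x : 'cV[R]_N) : R :=
  inf [set eucl (x - a) | a in S].

End HybridGeneric.

Section ClosedLoop.
Variables (R : realType) (n m q : nat).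

Definition sat_vec (ub : 'cV[R]_m) (v : 'cV[R]_m) : 'cV[R]_m :=
  \col_i (Order.min `|v i 0| (ub i 0) * Num.sg (v i 0)).
Definition dz_vec (ub : 'cV[R]_m) (v : 'cV[R]_m) : 'cV[R]_m := sat_vec ub v - v.

Definition Acl (A : 'M[R]_n) (B : 'M[R]_(n, m)) (K : 'M[R]_(m, n)) : 'M[R]_(n + n) :=
  block_mx (A + B *m K) (- (B *m K)) 0 A.
Definition Bcl (B : 'M[R]_(n, m)) : 'M[R]_(n + n, m) := col_mx B 0.
Definition Kcl (K : 'M[R]_(m, n)) : 'M[R]_(m, n + n) := row_mx K (- K).

Definition xbar (x : 'cV[R]_(n + n + q)) : 'cV[R]_(n + n) := usubmx x.
Definition xp (x : 'cV[R]_(n + n + q)) : 'cV[R]_n := usubmx (xbar x).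
Definition eta (x : 'cV[R]_(n + n + q)) : 'cV[R]_n := dsubmx (xbar x).
Definition tau (x : 'cV[R]_(n + n + q)) : 'cV[R]_q := dsubmx x.

Definition fcl A B K ub (x : 'cV[R]_(n + n + q)) : 'cV[R]_(n + n + q) :=
  col_mx (Acl A B K *m xbar x + Bcl B *m dz_vec ub (Kcl K *m xbar x))
         (const_mx (-1)).

Definition Tset (T2 : 'I_q -> R) : set 'cV[R]_q :=
  [set t | forall i, 0 <= t i 0 /\ t i 0 <= T2 i].
Definition Ccl T2 : set 'cV[R]_(n + n + q) := [set x | Tset T2 (tau x)].
Definition Di T2 (i : 'I_q) : set 'cV[R]_q := [set t | Tset T2 t /\ t i 0 = 0].
Definition Dcl T2 : set 'cV[R]_(n + n + q) := [set x | exists i, Di T2 i (tau x)].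

(* block structure of eta: block i occupies indices
   [bstart i, bstart i + ns i) *)
Definition bstart (ns : 'I_q -> nat) (i : 'I_q) : nat :=
  (\sum_(j < q | (j < i)%N) ns j)%N.
Definition hblk (ns : 'I_q -> nat) (i : 'I_q) (e : 'cV[R]_n) : 'cV[R]_n :=
  \col_k (if ((bstart ns i <= k) && (k < bstart ns i + ns i))%N then 0 else e k 0).

Definition Gcl ns T1 T2 (x : 'cV[R]_(n + n + q)) : set 'cV[R]_(n + n + q) :=
  [set g | exists i : 'I_q,
     [/\ Di T2 i (tau x), xp g = xp x, eta g = hblk ns i (eta x),
         T1 i <= tau g i 0 /\ tau g i 0 <= T2 i &
         forall k, k != i -> tau g k 0 = tau x k 0]].

Definition Aset T2 : set 'cV[R]_(n + n + q) :=
  [set a | xbar a = 0 /\ Tset T2 (tau a)].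
Definition distA T2 (x : 'cV[R]_(n + n + q)) : R := dist_set (Aset T2) x.

End ClosedLoop.

(* Main.v *)
(* Along a flow, V(phi) is absolutely continuous with derivative at most
   -c3 V(phi) almost everywhere, and jumps do not increase V; so V decays like
   exp(-c3 t) as long as the solution stays in a sublevel set included in
   U x T, and such sets are forward invariant.  Each jump raises
   sum_i tau_i / T1_i by at least one while flowing lowers it at a constant rate,
   so the number of jumps is affine in t, and decay in t is decay in t + j.
   A maximal solution of bounded speed is complete because it could otherwise be
   prolonged: by its limit at a missing right endpoint, by a jump when a timer
   vanishes, and by a Picard solution when none does. *)
Require Import Defs.
From HB Require Import structures.
From mathcomp Require Import all_boot all_order all_algebra.
From mathcomp Require Import all_classical all_reals all_analysis.
From mathcomp Require Import measurable_realfun ring lra.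
Set Implicit Arguments. Unset Strict Implicit. Unset Printing Implicit Defensive.
Import Order.TTheory GRing.Theory Num.Theory numFieldNormedType.Exports.
Local Open Scope classical_set_scope.
Local Open Scope ring_scope.

(** * Real induction *)

Section RealInduction.
Variable R : realType.
Implicit Types (a b x y z t : R).

Definition straddling a b x (P : R -> R -> Prop) : Prop :=
  exists2 d, 0 < d & forall y z, a <= y <= x -> x <= z <= b ->
    x - d < y -> z < x + d -> P y z.

Lemma straddling_near a b x (Q : set R) (P : R -> R -> Prop) :
  (\forall t \near x, Q t) ->
  (forall y z, a <= y <= x -> x <= z <= b -> (forall t, y <= t <= z -> Q t) ->
     P y z) ->
  straddling a b x P.
Proof.
move=> /nbhs_ballP[d /= d0 dQ] QP; exists d => // y z axy xzb dy zd.
apply: QP => // t /andP[yt tz]; apply: dQ; rewrite /ball /= ltr_norml.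
by apply/andP; split; lra.
Qed.

Lemma real_induction a b (P : R -> Prop) :
  a <= b -> P a ->
  (forall x, a <= x <= b -> straddling a b x (fun y z => P y -> P z)) ->
  P b.
Proof.
move=> ab Pa step.
pose E := [set x | a <= x <= b /\ P x].
have Ea : E a by split; rewrite ?lexx.
have supE : has_sup E by split; [exists a|exists b => x [/andP[]]].
have ac : a <= sup E by apply: ub_le_sup => //; case: supE.
have cb : sup E <= b by apply: ge_sup => [|x [/andP[]]]; first by exists a.
have [|d d0 stepc] := step (sup E); first by rewrite ac.
have [y [/andP[ay yb] Py] yc] := sup_adherent d0 supE.
have yle : y <= sup E by apply: ub_le_sup; [case: supE|split; rewrite ?ay].
pose z := Num.min b (sup E + d / 2).
have zb : z <= b by rewrite ge_min lexx.
have cz : sup E <= z by rewrite le_min cb; lra.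
have zd : z < sup E + d by rewrite gt_min; apply/orP; right; lra.
have Pz : P z by apply: stepc Py; rewrite ?ay ?yle ?cz ?zb.
have : z <= sup E by apply: ub_le_sup; [case: supE|split => //; lra].
rewrite /z ge_min => /orP[bc|]; last lra.
by have <- : z = b by apply/eqP; rewrite eq_le zb (le_trans bc).
Qed.

End RealInduction.

(** * Lipschitz functions *)

Section Lipschitz.
Variables (R : realType) (V W : normedModType R).

Lemma klipschitzP (k : R) (A : set V) (f : V -> W) :
  k.-lipschitz_A f <->
  (forall x y, A x -> A y -> `|f x - f y| <= k * `|x - y|).
Proof.
split=> [lipf x y Ax Ay|lipf [x y] [Ax Ay]]; last exact: lipf.
exact: (lipf (x, y)).
Qed.

Lemma klipschitz_continuous (k : R) (f : V -> W) : k.-lipschitz f -> continuous f.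
Proof.
move=> /klipschitzP lipf x; apply/cvgrPdist_lt => e e0.
have k1 : 0 < `|k| + 1 by rewrite ltr_wpDl.
apply/nbhs_ballP; exists (e / (`|k| + 1)) => [|y]; first exact: divr_gt0.
rewrite -ball_normE /= ltr_pdivlMr // mulrC; apply: le_lt_trans.
apply: le_trans (lipf x y I I) _; rewrite ler_wpM2r //.
by rewrite (le_trans (ler_norm k)) // lerDl.
Qed.

Lemma klipschitzD (k1 k2 : R) (A : set V) (f g : V -> W) :
  k1.-lipschitz_A f -> k2.-lipschitz_A g ->
  (k1 + k2).-lipschitz_A (fun x => f x + g x).
Proof.
move=> /klipschitzP lipf /klipschitzP lipg; apply/klipschitzP => x y Ax Ay.
rewrite opprD addrACA mulrDl; apply: le_trans (ler_normD _ _) _.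
by apply: lerD; [exact: lipf|exact: lipg].
Qed.

End Lipschitz.

Lemma klipschitz_comp (R : realType) (U V W : normedModType R) (k1 k2 : R)
    (f : V -> W) (g : U -> V) :
  0 <= k1 -> k1.-lipschitz f -> k2.-lipschitz g -> (k1 * k2).-lipschitz (f \o g).
Proof.
move=> k10 /klipschitzP lipf /klipschitzP lipg; apply/klipschitzP => x y _ _.
by apply: le_trans (lipf _ _ I I) _; rewrite -mulrA ler_wpM2l ?lipg.
Qed.

Lemma klipschitz_monotoneP (R : realType) (V : normedModType R) (k : R)
    (A : set R) (f : R -> V) :
  k.-lipschitz_A f <->
  (forall s t, A s -> A t -> s <= t -> `|f t - f s| <= k * (t - s)).
Proof.
split=> [/klipschitzP lipf s t As At st|lipf].
  by rewrite -[t - s]ger0_norm ?subr_ge0 //; exact: lipf.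
apply/klipschitzP => s t As At; have [st|/ltW ts] := leP s t.
  by rewrite distrC [`|s - t|]distrC ger0_norm ?subr_ge0 //; exact: lipf.
by rewrite [`|s - t|]ger0_norm ?subr_ge0 //; exact: lipf.
Qed.

(** * Absolutely continuous functions *)

Section IntervalChains.
Variable R : realType.
Implicit Types (a b c : R) (s : seq (R * R)).

Definition interval_chain a b s : bool :=
  all (fun p => a <= p.1 <= p.2) s && all (fun p => p.2 <= b) s &&
  pairwise (fun p q => p.2 <= q.1) s.

Lemma interval_chain_rcons a b s y z :
  interval_chain a y s -> a <= y <= z -> z <= b ->
  interval_chain a b (rcons s (y, z)).
Proof.
move=> /andP[/andP[incr /allP bnd] disj] ayz zb.
rewrite /interval_chain !all_rcons /= ayz zb incr pairwise_rcons disj !andbT.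
apply/andP; split; apply/allP => p /bnd //= py.
by apply: le_trans py (le_trans _ zb); case/andP: ayz.
Qed.

Lemma interval_chain_rconsE a b s y z :
  interval_chain a b (rcons s (y, z)) ->
  [/\ interval_chain a y s, a <= y <= z & z <= b].
Proof.
rewrite /interval_chain !all_rcons pairwise_rcons /=.
by move=> /andP[/andP[/andP[ayz ->]] /andP[zb _] /andP[-> ->]].
Qed.

Lemma interval_chain_widen a b c s :
  b <= c -> interval_chain a b s -> interval_chain a c s.
Proof.
move=> bc /andP[/andP[incr /allP bnd] disj]; rewrite /interval_chain incr disj andbT.
by apply/allP => p /bnd /le_trans; apply.
Qed.

Lemma interval_chain_length_le (Z : set R) a b s :
  measurable Z -> interval_chain a b s ->
  (forall p, p \in s -> `[p.1, p.2[ `<=` Z) ->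
  ((\sum_(p <- s) (p.2 - p.1))%:E <= lebesgue_measure (Z `&` `[a, b[%classic))%E.
Proof.
move=> mZ; elim/last_ind: s b => [|s [y z] IH] b.
  by rewrite big_nil => _ _; exact: measure_ge0.
move=> /interval_chain_rconsE[chs /andP[ay yz] zb] sZ.
have yzZ : `[y, z[ `<=` Z by apply: (sZ (y, z)); rewrite mem_rcons mem_head.
have {}IH : ((\sum_(p <- s) (p.2 - p.1))%:E <=
    lebesgue_measure (Z `&` `[a, y[%classic))%E.
  by apply: IH => // p ps; apply: sZ; rewrite mem_rcons inE ps orbT.
have yz_length : ((z - y)%:E <= lebesgue_measure (`[y, z[%classic : set R))%E.
  rewrite lebesgue_measure_itv /= lte_fin.
  by case: ifPn => [_|]; [rewrite EFinB|rewrite -leNgt lee_fin subr_le0].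
have mZI c : measurable (Z `&` `[a, c[%classic) by exact: measurableI.
apply: (@le_trans _ _ (lebesgue_measure ((Z `&` `[a, y[%classic) `|` `[y, z[%classic))).
  rewrite big_rcons /= EFinD measureU; [|exact: mZI|by []|]; last first.
    rewrite -subset0 => t [[_ /=]]; rewrite !in_itv /= => /andP[_ ty] /andP[yt _].
    by rewrite leNgt ty in yt.
  exact: leeD IH yz_length.
apply: le_measure; rewrite ?inE; [by apply: measurableU; [exact: mZI|]|exact: mZI|].
move=> t [[Zt]|/[dup]/yzZ Zt]; rewrite /= !in_itv /= => /andP[t1 t2]; split=> //.
  by rewrite t1 (lt_le_trans t2 (le_trans yz zb)).
by rewrite (le_trans ay t1) (lt_le_trans t2 zb).
Qed.

(* Off [Z] the increments of [W] are controlled pointwise; inside the open set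
   [Z] they are merely recorded, interval by interval. *)
Lemma increment_le_chain (W : R -> R) (Z : set R) a b e :
  a <= b -> 0 <= e -> open Z ->
  (forall x, a <= x <= b -> ~ Z x ->
     straddling a b x (fun y z => W z - W y <= e * (z - y))) ->
  exists s, [/\ interval_chain a b s, (forall p, p \in s -> `[p.1, p.2[ `<=` Z) &
    W b - W a <= e * (b - a) + \sum_(p <- s) `|W p.2 - W p.1|].
Proof.
move=> ab e0 oZ WZ; pattern b.
apply: (real_induction ab) => [|x axb].
  by exists [::]; split; rewrite // big_nil !subrr mulr0 addr0.
have [Zx|nZx] := pselect (Z x); last first.
  have [d d0 Wd] := WZ x axb nZx; exists d => // y z axy xzb dy zd [s [chs sZ Ws]].
  have := Wd y z axy xzb dy zd; case/andP: axy xzb => ay yx /andP[xz zb] Wyz.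
  by exists s; split => //; [apply: interval_chain_widen chs; lra|nra].
apply: (straddling_near (oZ x Zx)) => y z /andP[ay yx] /andP[xz zb] yzZ [s [chs sZ Ws]].
exists (rcons s (y, z)); split.
- by apply: interval_chain_rcons; rewrite // ay (le_trans yx).
- move=> p; rewrite mem_rcons inE => /orP[/eqP->|/sZ//] t /=.
  by rewrite in_itv /= => /andP[yt tz]; apply: yzZ; rewrite yt ltW.
- by rewrite big_rcons /=; have := ler_norm (W z - W y); nra.
Qed.

End IntervalChains.

Section AbsolutelyContinuous.
Variable R : realType.

(* [abs_cont_on] for an arbitrary normed module, with which it is convertible
   on column vectors. *)
Definition abs_cont (V : normedModType R) (g : R -> V) (a b : R) : Prop :=
  forall e : R, 0 < e -> exists2 d : R, 0 < d &
    forall (K : nat) (u v : nat -> R),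
      (forall k, (k < K)%N -> a <= u k /\ u k <= v k /\ v k <= b) ->
      (forall k l, (k < K)%N -> (l < K)%N -> k <> l ->
                   v k <= u l \/ v l <= u k) ->
      \sum_(k < K) (v k - u k) < d ->
      \sum_(k < K) `|g (v k) - g (u k)| < e.

Lemma abs_cont_chain (V : normedModType R) (g : R -> V) a b e :
  abs_cont g a b -> 0 < e -> exists2 d : R, 0 < d &
    forall s, interval_chain a b s -> \sum_(p <- s) (p.2 - p.1) < d ->
      \sum_(p <- s) `|g p.2 - g p.1| < e.
Proof.
move=> acg e0; have [d d0 gd] := acg e e0; exists d => // s.
move=> /andP[/andP[/all_nthP incr /all_nthP bnd] /pairwiseP disj].
rewrite !(big_nth (0, 0)) !big_mkord.
apply: (gd (size s) (fun k => (nth (0, 0) s k).1) (fun k => (nth (0, 0) s k).2)).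
  by move=> k ks; have := bnd (0, 0) k ks; have /andP[] := incr (0, 0) k ks.
move=> k l ks ls /eqP; rewrite neq_ltn => /orP[kl|lk]; [left|right]; exact: disj.
Qed.

Section Operations.
Variables (V W : normedModType R).
Implicit Types (g : R -> V) (h : R -> W) (a b c d : R).

Lemma abs_cont_sub g a b c d :
  a <= c -> d <= b -> abs_cont g a b -> abs_cont g c d.
Proof.
move=> ac db acg e e0; have [r r0 gr] := acg e e0; exists r => // K u v uv.
apply: gr => k /uv[cu [uv' vd]]; split; first exact: le_trans cu.
by split => //; exact: le_trans db.
Qed.

Lemma abs_cont_dominated (Y : normedModType R) (F : R -> Y) g h a b L :
  abs_cont g a b -> abs_cont h a b ->
  (forall s t, a <= s -> s <= t -> t <= b ->
     `|F t - F s| <= L * (`|g t - g s| + `|h t - h s|)) ->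
  abs_cont F a b.
Proof.
move=> acg ach FL e e0.
have L0 : 0 < 2 * (`|L| + 1) by rewrite mulr_gt0 // ltr_wpDl.
have e'0 := divr_gt0 e0 L0.
have [d1 d10 gd] := acg _ e'0; have [d2 d20 hd] := ach _ e'0.
exists (Num.min d1 d2) => [|K u v uv disj]; first by rewrite lt_min d10.
rewrite lt_min => /andP[/(gd K u v uv disj) gK /(hd K u v uv disj) hK].
apply: (@le_lt_trans _ _ ((`|L| + 1) *
    (\sum_(k < K) `|g (v k) - g (u k)| + \sum_(k < K) `|h (v k) - h (u k)|))).
  rewrite -big_split /= mulr_sumr; apply: ler_sum => k _.
  have [au [uv' vb]] := uv k (ltn_ord k); apply: le_trans (FL _ _ au uv' vb) _.
  by rewrite ler_wpM2r // ?addr_ge0 // (le_trans (ler_norm L)) // lerDl.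
rewrite ltr_pdivlMr // in gK; rewrite ltr_pdivlMr // in hK.
by move: (\sum_(k < K) _) (\sum_(k < K) _) gK hK => p r; lra.
Qed.

Lemma klipschitz_abs_cont g a b M : M.-lipschitz_`[a, b] g -> abs_cont g a b.
Proof.
move=> /klipschitz_monotoneP lipg e e0.
have M0 : 0 < `|M| + 1 by rewrite ltr_wpDl.
exists (e / (`|M| + 1)) => [|K u v uv _]; first exact: divr_gt0.
rewrite ltr_pdivlMr // mulrC; apply: le_lt_trans.
rewrite mulr_sumr; apply: ler_sum => k _; have [au [uv' vb]] := uv k (ltn_ord k).
apply: le_trans (lipg _ _ _ _ uv') _; rewrite /= ?in_itv /= ?au ?vb ?andbT.
- exact: le_trans uv' vb.
- exact: le_trans au uv'.
- by rewrite ler_wpM2r ?subr_ge0 // (le_trans (ler_norm M)) // lerDl.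
Qed.

Lemma abs_cont_near g a b x e : abs_cont g a b -> 0 < e -> a <= x <= b ->
  \forall t \near x, a <= t <= b -> `|g t - g x| < e.
Proof.
move=> acg e0 /andP[ax xb]; have [d d0 gd] := acg e e0.
have incr s t : a <= s -> s <= t -> t <= b -> t - s < d -> `|g t - g s| < e.
  move=> as_ st tb std; have := gd 1%N (fun=> s) (fun=> t).
  rewrite !big_ord1; apply => //.
  by move=> k l; rewrite !ltnS !leqn0 => /eqP-> /eqP->.
apply/nbhs_ballP; exists d => // t.
rewrite /ball /= ltr_distl => /andP[xd dx] /andP[at_ tb].
have [xt|/ltW tx] := leP x t; first by apply: incr => //; lra.
by rewrite distrC; apply: incr => //; lra.
Qed.

End Operations.

Section Gluing.
Variable V : normedModType R.
Implicit Types (g : R -> V) (a b c d : R).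

Lemma eq_abs_cont g1 g2 a b : (forall t, a <= t <= b -> g1 t = g2 t) ->
  abs_cont g1 a b -> abs_cont g2 a b.
Proof.
move=> g12 acg; apply: (abs_cont_dominated (L := 1) acg acg) => s t as_ st tb.
by rewrite !g12 ?as_ ?tb ?(le_trans as_) ?(le_trans st) // mul1r lerDl.
Qed.

Lemma abs_cont_comp_nondecreasing g (m : R -> R) a b c d :
  abs_cont g c d -> (forall t, a <= t <= b -> c <= m t <= d) ->
  (forall s t, s <= t -> m s <= m t <= m s + (t - s)) ->
  abs_cont (g \o m) a b.
Proof.
move=> acg m_itv m_incr e e0; have [r r0 gr] := acg e e0.
exists r => // K u v uv disj len.
apply: (gr K (m \o u) (m \o v)) => /=.
- move=> k /uv[au [uv' vb]].
  have /andP[mu_mv _] := m_incr _ _ uv'.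
  have /andP[cmu _] : c <= m (u k) <= d by apply: m_itv; rewrite au (le_trans uv').
  by have /andP[_ mvd] : c <= m (v k) <= d by apply: m_itv; rewrite vb (le_trans au).
- move=> k l kK lK /(disj k l kK lK)[] /m_incr/andP[? _]; [by left|by right].
- apply: le_lt_trans len; apply: ler_sum => k _.
  by have [_ [/m_incr/andP[_ + _]]] := uv k (ltn_ord k); rewrite lerBlDl.
Qed.

(* An interval straddling [c] is cut at [c] by clamping both of its ends. *)
Lemma abs_cont_cat g a b c :
  a <= c -> c <= b -> abs_cont g a c -> abs_cont g c b -> abs_cont g a b.
Proof.
move=> ac cb acl acr.
have ac_min : abs_cont (g \o Num.min^~ c) a b.
  apply: abs_cont_comp_nondecreasing acl _ _ => [t /andP[at_ _]|s t st].
    by rewrite le_min at_ ac ge_min lexx orbT.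
  by have [tc|ct] := leP t c; have [sc|cs] := leP s c; apply/andP; split; lra.
have ac_max : abs_cont (g \o Num.max^~ c) a b.
  apply: abs_cont_comp_nondecreasing acr _ _ => [t /andP[_ tb]|s t st].
    by rewrite ge_max tb cb le_max lexx orbT.
  by have [tc|ct] := leP t c; have [sc|cs] := leP s c; apply/andP; split; lra.
apply: (abs_cont_dominated (L := 1) ac_min ac_max) => s t _ st _; rewrite mul1r /=.
have [tc|ct] := leP t c; have [sc|cs] := leP s c;
  rewrite ?subrr ?normr0 ?add0r ?addr0 //; last by rewrite [leRHS]addrC ler_distD.
by have := le_lt_trans (le_trans st tc) cs; rewrite ltxx.
Qed.

Lemma abs_cont_local g a b : a <= b ->
  (forall x, a <= x <= b -> straddling a b x (abs_cont g)) -> abs_cont g a b.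
Proof.
move=> ab loc; apply: (@real_induction _ a b (abs_cont g a)) => // [|x axb].
  apply: (klipschitz_abs_cont (M := 0)); apply/klipschitzP => s t /=.
  rewrite !in_itv /= => /andP[? ?] /andP[? ?].
  by rewrite (_ : s = t) ?subrr ?normr0 ?mul0r //; lra.
have [d d0 acd] := loc x axb; exists d => // y z axy xzb dy zd acy.
have [/andP[ay yx] /andP[xz _]] := conj axy xzb.
by apply: (abs_cont_cat ay (le_trans yx xz) acy); exact: acd.
Qed.

End Gluing.

End AbsolutelyContinuous.

#[local] Instance lebesgue_ae_filter (R : realType) :
  Filter (nbhs (almost_everywhere (@lebesgue_measure R))) :=
  ae_filter_ringOfSetsType _.

Section DerivativeBounds.
Variable R : realType.
Implicit Types (W : R -> R) (a b t x M : R).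

Lemma is_derive_near W x w e : is_derive x 1 W w -> 0 < e ->
  \forall t \near x, `|W t - W x - w * (t - x)| <= e * `|t - x|.
Proof.
move=> [dW Ww] e0.
have cvW : h^-1 *: ((W \o shift x) (h *: 1) - W x) @[h --> 0^'] --> w.
  by rewrite -Ww; exact: dW.
move/cvgrPdist_le: cvW => /(_ _ e0) /nbhs_ballP[d /= d0 We].
apply/nbhs_ballP; exists d => // t; rewrite -ball_normE /= distrC => tx.
have [->|neq] := eqVneq t x; first by rewrite !subrr mulr0 subrr normr0 mulr0.
have h0 : t - x != 0 by rewrite subr_eq0.
have := We (t - x); rewrite /ball /= sub0r normrN => /(_ tx h0).
rewrite [_ *: 1]mulr1 subrK.
have -> : W t - W x - w * (t - x) = - ((w - (t - x)^-1 *: (W t - W x)) * (t - x)).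
  by rewrite /GRing.scale /=; field.
by rewrite normrN normrM => quotient_le; rewrite ler_wpM2r.
Qed.

Lemma straddling_derive_le0 W a b x w e : is_derive x 1 W w -> w <= 0 -> 0 < e ->
  straddling a b x (fun y z => W z - W y <= e * (z - y)).
Proof.
move=> dW w0 e0; apply: (straddling_near (is_derive_near dW e0)).
move=> y z /andP[ay yx] /andP[xz zb] Wyz.
have yz := le_trans yx xz.
have := Wyz y; have := Wyz z; rewrite !lexx yz => /(_ isT) + /(_ isT).
rewrite [`|z - x|]ger0_norm ?subr_ge0 // [`|y - x|]ler0_norm ?subr_le0 //.
by move=> /ler_normlP[_ Wz] /ler_normlP[Wy _]; nra.
Qed.

(* The exceptional null set is covered by an open set [Z] so small that, [W]
   being absolutely continuous, the increments over intervals of [Z] add up to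
   less than [e]. *)
Lemma abs_cont_nonincreasing W a b : a <= b -> abs_cont W a b ->
  (\forall t \ae (@lebesgue_measure R), a <= t <= b ->
     exists2 w, is_derive t 1 W w & w <= 0) ->
  W b <= W a.
Proof.
move=> ab acW [N [mN N0 WN]].
suff increment e : 0 < e -> W b - W a <= e * (b - a) + e.
  apply/ler_addgt0Pr => e e0.
  have M0 : 0 < b - a + 1 by lra.
  have := increment _ (divr_gt0 e0 M0).
  have -> : e / (b - a + 1) * (b - a) + e / (b - a + 1) = e by field; lra.
  by rewrite lerBlDl.
move=> e0; have [d d0 Wd] := abs_cont_chain acW e0.
have [Z [oZ NZ muZ]] : exists Z : set R,
    [/\ open Z, N `<=` Z & (lebesgue_measure (Z `\` N) < d%:E)%E].
  by apply: lebesgue_regularity_outer => //; rewrite [X in (X < _)%E]N0.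
have mZ : measurable Z by exact: open_measurable.
have [s [chs sZ Ws]] : exists s, [/\ interval_chain a b s,
    (forall p, p \in s -> `[p.1, p.2[ `<=` Z) &
    W b - W a <= e * (b - a) + \sum_(p <- s) `|W p.2 - W p.1|].
  apply: increment_le_chain => // [|x axb nZx]; first exact: ltW.
  have [w dW w0] : exists2 w, is_derive x 1 W w & w <= 0.
    by apply: contrapT => nW; apply: nZx; apply: NZ; apply: WN => /= /(_ axb).
  exact: straddling_derive_le0 dW w0 e0.
apply: le_trans Ws _; rewrite lerD2l; apply/ltW/Wd => //.
rewrite -lte_fin; apply: le_lt_trans (interval_chain_length_le mZ chs sZ) _.
apply: (@le_lt_trans _ _ (lebesgue_measure Z)).
  by apply: le_measure; rewrite ?inE //; exact: measurableI.
rewrite -(setDKU NZ); apply: le_lt_trans (measureU2 _ _ _) _ => //.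
  exact: measurableD.
by rewrite [X in (_ + X)%E]N0 adde0.
Qed.

Lemma abs_cont_increment_le W a b M : a <= b -> abs_cont W a b ->
  (\forall t \ae (@lebesgue_measure R), a <= t <= b ->
     exists2 w, is_derive t 1 W w & w <= M) ->
  W b - W a <= M * (b - a).
Proof.
move=> ab acW WM.
suff : W b - M * b <= W a - M * a by rewrite mulrBr; lra.
apply: (@abs_cont_nonincreasing (fun t => W t - M * t)) => //.
  have ac_id : abs_cont (id : R -> R) a b.
    by apply: (@klipschitz_abs_cont _ _ _ _ _ 1); apply/klipschitzP => *; rewrite mul1r.
  apply: (abs_cont_dominated (L := 1 + `|M|) acW ac_id) => s t _ _ _.
  have -> : W t - M * t - (W s - M * s) = (W t - W s) - M * (t - s) by ring.
  apply: le_trans (ler_normB _ _) _; rewrite normrM.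
  by have := normr_ge0 M; have := normr_ge0 (W t - W s); have := normr_ge0 (t - s); nra.
apply: filterS WM => t W_le /W_le[w dW wM]; exists (w - M); last by rewrite subr_le0.
have -> : (fun t => W t - M * t) = W - M \*: id by apply/funext.
by apply: is_derive_eq; rewrite [M *: 1]mulr1.
Qed.

Lemma abs_cont_increment_ge W a b M : a <= b -> abs_cont W a b ->
  (\forall t \ae (@lebesgue_measure R), a <= t <= b ->
     exists2 w, is_derive t 1 W w & M <= w) ->
  M * (b - a) <= W b - W a.
Proof.
move=> ab acW WM.
suff : - W b - - W a <= - M * (b - a) by lra.
apply: (@abs_cont_increment_le (fun t => - W t)) => //.
  by apply: (abs_cont_dominated (L := 1) acW acW) => s t _ _ _;
     rewrite -opprD normrN mul1r lerDl.
apply: filterS WM => t W_ge /W_ge[w dW Mw].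
by exists (- w); [exact: is_deriveN|rewrite lerN2].
Qed.

Lemma abs_cont_increment_eq W a b w : a <= b -> abs_cont W a b ->
  (\forall t \ae (@lebesgue_measure R), a <= t <= b -> is_derive t 1 W w) ->
  W b - W a = w * (b - a).
Proof.
move=> ab acW dW; apply/eqP; rewrite eq_le; apply/andP; split.
  by apply: abs_cont_increment_le => //; apply: filterS dW => t dW /dW; exists w.
by apply: abs_cont_increment_ge => //; apply: filterS dW => t dW /dW; exists w.
Qed.

Lemma is_derive_klipschitz W (W' : R -> R) a b M :
  (forall t, a <= t <= b -> is_derive t 1 W (W' t)) ->
  (forall t, a <= t <= b -> `|W' t| <= M) -> M.-lipschitz_`[a, b] W.
Proof.
move=> dW W'M; apply/klipschitz_monotoneP => s t /=.
rewrite !in_itv /= => /andP[as_ sb] /andP[at_ tb] st.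
have st_sub r : s <= r <= t -> a <= r <= b.
  by move=> /andP[sr rt]; rewrite (le_trans as_) ?(le_trans rt).
have [||r] := @MVT_segment R W W' s t st.
- move=> r; rewrite in_itv /= => /andP[sr rt]; apply/dW/st_sub.
  by rewrite !ltW.
- apply: derivable_within_continuous => r; rewrite in_itv /= => /st_sub rab.
  by have [] := dW r rab.
rewrite in_itv /= => /st_sub /W'M W'rM ->.
by rewrite normrM [`|t - s|]ger0_norm ?subr_ge0 // ler_wpM2r ?subr_ge0.
Qed.

Lemma abs_cont_bounded (V : normedModType R) (g : R -> V) a b :
  a <= b -> abs_cont g a b -> exists M, forall t, a <= t <= b -> `|g t| <= M.
Proof.
move=> ab acg; pattern b; apply: (real_induction ab) => [|x axb].
  by exists `|g a| => t at_; rewrite (_ : t = a) //; apply: le_anti; rewrite andbC.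
apply: (straddling_near (abs_cont_near acg ltr01 axb)).
move=> y z /andP[ay yx] /andP[xz zb] gyz [M gM].
exists (Num.max M (`|g x| + 1)) => t /andP[at_ tz]; rewrite le_max.
have [ty|/ltW yt] := leP t y; first by rewrite gM ?at_.
apply/orP; right; rewrite -[g t](subrK (g x)).
apply: le_trans (ler_normD _ _) _; rewrite addrC lerD2l ltW // gyz ?yt //.
by rewrite at_ (le_trans tz).
Qed.

Lemma abs_contM W (F : R -> R) a b :
  a <= b -> abs_cont W a b -> abs_cont F a b -> abs_cont (fun t => W t * F t) a b.
Proof.
move=> ab acW acF.
have [MW W_le] := abs_cont_bounded ab acW; have [MF F_le] := abs_cont_bounded ab acF.
have MW0 : 0 <= MW by apply: le_trans (W_le a _); rewrite ?lexx.
have MF0 : 0 <= MF by apply: le_trans (F_le a _); rewrite ?lexx.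
apply: (abs_cont_dominated (L := MW + MF) acW acF) => s t as_ st tb.
have -> : W t * F t - W s * F s = W t * (F t - F s) + F s * (W t - W s) by ring.
apply: le_trans (ler_normD _ _) _; rewrite !normrM.
have Wt := W_le t; rewrite (le_trans as_ st) tb in Wt.
have Fs := F_le s; rewrite as_ (le_trans st tb) in Fs.
apply: le_trans (lerD (ler_wpM2r _ (Wt isT)) (ler_wpM2r _ (Fs isT))) _ => //.
by have := normr_ge0 (W t - W s); have := normr_ge0 (F t - F s); nra.
Qed.

Lemma is_derive_expRM r t :
  is_derive t 1 (fun s => expR (r * s)) (r * expR (r * t)).
Proof.
have dl : is_derive t (1 : R) (fun s => r * s) r.
  have -> : (fun s => r * s) = r \*: id by apply/funext.
  by apply: is_derive_eq; rewrite [_ *: 1]mulr1.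
have := @is_derive1_comp R expR (fun s => r * s) t _ _ (is_derive_expR _) dl.
by rewrite mulrC.
Qed.

Lemma abs_cont_expRM r a b : abs_cont (fun s => expR (r * s)) a b.
Proof.
apply: (klipschitz_abs_cont (M := `|r| * expR (`|r| * (`|a| + `|b|)))).
apply: is_derive_klipschitz (fun t _ => is_derive_expRM r t) _ => t /andP[at_ tb].
rewrite normrM [`|expR _|]ger0_norm ?expR_ge0 // ler_wpM2l // ler_expR.
apply: le_trans (ler_norm _) _; rewrite normrM ler_wpM2l // ler_norml.
have := ler_norm b; have := ler_norm (- a); rewrite normrN.
by have := normr_ge0 a; have := normr_ge0 b; lra.
Qed.

Lemma abs_cont_gronwall W a b r : a <= b -> abs_cont W a b ->
  (\forall t \ae (@lebesgue_measure R), a <= t <= b ->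
     exists2 w, is_derive t 1 W w & w <= - r * W t) ->
  W b <= expR (- r * (b - a)) * W a.
Proof.
move=> ab acW dW.
have decay : expR (r * b) * W b <= expR (r * a) * W a.
  apply: (@abs_cont_nonincreasing (fun t => expR (r * t) * W t)) => //.
    by apply: abs_contM => //; exact: abs_cont_expRM.
  apply: filterS dW => t dWt /dWt[w {}dWt w_le].
  exists (expR (r * t) *: w + W t *: (r * expR (r * t))).
    by have dE := is_derive_expRM r t; exact: (is_deriveM dE dWt).
  by rewrite /GRing.scale /=; have := expR_gt0 (r * t); nra.
have -> : - r * (b - a) = r * a - r * b by ring.
by rewrite expRB mulrAC ler_pdivlMr ?expR_gt0 // mulrC.
Qed.

End DerivativeBounds.

(** * Column vectors *)

Section ColumnVectors.
Variables (R : realType) (N : nat).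
Implicit Types (x : 'cV[R]_N) (g : R -> 'cV[R]_N) (a b t M : R).

Lemma coord_le_norm x i : `|x i 0| <= `|x|.
Proof.
rewrite [leRHS]/Num.Def.normr /= mx_normrE.
exact: (le_bigmax _ (fun ij : 'I_N * 'I_1 => `|x ij.1 ij.2|) (i, 0)).
Qed.

Lemma norm_le_coord x M : 0 <= M -> (forall i, `|x i 0| <= M) -> `|x| <= M.
Proof.
move=> M0 xM; rewrite [leLHS]/Num.Def.normr /= mx_normrE.
by apply: bigmax_le => // -[i j] _ /=; rewrite ord1.
Qed.

Lemma is_derive_colP g t (v : 'cV[R]_N) :
  is_derive t 1 g v <-> (forall i, is_derive t 1 (fun s => g s i 0) (v i 0)).
Proof.
split=> [[dg <-] i|dg].
  by split; [move/derivable_mxP: dg => /(_ i 0)|rewrite derive_mx // mxE].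
have dmx : derivable g t 1 by apply/derivable_mxP => i j; rewrite ord1; have [] := dg i.
split=> //; rewrite derive_mx //; apply/matrixP => i j.
by rewrite mxE ord1; have [] := dg i.
Qed.

Lemma is_derive_col_klipschitz g (g' : R -> 'cV[R]_N) a b M :
  (forall t, a <= t <= b -> is_derive t 1 g (g' t)) ->
  (forall t, a <= t <= b -> `|g' t| <= M) -> M.-lipschitz_`[a, b] g.
Proof.
move=> dg g'M; apply/klipschitzP => s t sab tab.
have M0 : 0 <= M by apply: le_trans (g'M s _) => //; move: sab; rewrite /= in_itv.
apply: norm_le_coord => [|i]; first exact: mulr_ge0.
have /klipschitzP/(_ s t sab tab) : M.-lipschitz_`[a, b] (fun t => g t i 0).
  apply: (@is_derive_klipschitz _ _ (fun t => g' t i 0)) => r rab.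
    by have /is_derive_colP := dg r rab.
  exact: le_trans (coord_le_norm _ _) (g'M r rab).
by rewrite !mxE.
Qed.

Lemma abs_cont_coord g a b i : abs_cont g a b -> abs_cont (fun t => g t i 0 : R) a b.
Proof.
move=> acg; apply: (abs_cont_dominated (L := 1) acg acg) => s t _ _ _.
have := coord_le_norm (g t - g s) i; rewrite !mxE mul1r => /le_trans; apply.
by rewrite lerDl.
Qed.

Lemma abs_cont_ae_klipschitz g a b M : abs_cont g a b ->
  (\forall t \ae (@lebesgue_measure R), a <= t <= b ->
     exists2 v, is_derive t 1 g v & `|v| <= M) ->
  0 <= M -> M.-lipschitz_`[a, b] g.
Proof.
move=> acg gM M0; apply/klipschitz_monotoneP => s t /=.
rewrite !in_itv /= => /andP[as_ _] /andP[_ tb] st.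
have acgi i := abs_cont_coord i (abs_cont_sub as_ tb acg).
have giM i : \forall r \ae (@lebesgue_measure R), s <= r <= t ->
    exists2 w, is_derive r 1 (fun s => g s i 0) w & `|w| <= M.
  apply: filterS gM => r gM /andP[sr rt].
  have [|v dv vM] := gM; first by rewrite (le_trans as_) // (le_trans rt).
  exists (v i 0); last exact: le_trans (coord_le_norm _ _) vM.
  by move: i; apply/is_derive_colP.
apply: norm_le_coord => [|i]; first by rewrite mulr_ge0 // subr_ge0.
rewrite !mxE ler_norml -mulNr; apply/andP; split.
  apply: (abs_cont_increment_ge st (acgi i)).
  apply: filterS (giM i) => r dgr /dgr[w dw].
  by rewrite ler_norml => /andP[]; exists w.
apply: (abs_cont_increment_le st (acgi i)).
apply: filterS (giM i) => r dgr /dgr[w dw].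
by rewrite ler_norml => /andP[]; exists w.
Qed.

End ColumnVectors.

(** * Continuously differentiable functions *)

Lemma ball_segment (R : realType) (X : normedModType R) (x y z : X) (r t : R) :
  0 <= t <= 1 -> ball x r y -> ball x r z -> ball x r (y + t *: (z - y)).
Proof.
move=> /andP[t0 t1]; rewrite -!ball_normE /= => xy xz.
have -> : x - (y + t *: (z - y)) = (1 - t) *: (x - y) + t *: (x - z).
  rewrite opprD addrA -scalerN opprB -[x - z](subrKA y).
  by rewrite [t *: (_ + (y - z))]scalerDr [RHS]addrA -scalerDl subrK scale1r.
apply: le_lt_trans (ler_normD _ _) _; rewrite !normrZ.
rewrite [`|1 - t|]ger0_norm ?subr_ge0 // [`|t|]ger0_norm //.
by have [t05|t05] := leP t (1 / 2); nra.
Qed.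

Section ContinuouslyDifferentiable.
Variables (R : realType) (N : nat).
Implicit Types (V : 'cV[R]_N -> R) (x y z v : 'cV[R]_N) (g : R -> 'cV[R]_N).

Lemma is_derive_comp_diff V g (t : R) v :
  differentiable V (g t) -> is_derive t 1 g v ->
  is_derive t 1 (V \o g) ('d V (g t) v).
Proof.
move=> dV [dg <-]; have dg' : differentiable g t by apply/derivable1_diffP.
have dVg : differentiable (V \o g) t by apply: differentiable_comp.
split; first by apply/derivable1_diffP.
by rewrite !deriveE // diff_comp.
Qed.

Lemma diff_coordE V x v : 'd V x v = \sum_i v i 0 * 'd V x (delta_mx i 0).
Proof.
rewrite {1}(matrix_sum_delta v) linear_sum /=; apply: eq_bigr => i _.
by rewrite big_ord1 linearZ.
Qed.

Lemma diff_norm_le V x v :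
  `|'d V x v| <= (\sum_i `|'d V x (delta_mx i 0)|) * `|v|.
Proof.
rewrite diff_coordE mulr_suml; apply: le_trans (ler_norm_sum _ _ _) _.
by apply: ler_sum => i _; rewrite normrM mulrC ler_wpM2l // coord_le_norm.
Qed.

Lemma C1_diff_continuous V (f : 'cV[R]_N -> 'cV[R]_N) :
  C1 V -> continuous f -> continuous (fun x => 'd V x (f x)).
Proof.
move=> [_ cdV] cf.
have -> : (fun x => 'd V x (f x)) =
    (fun x => \sum_i f x i 0 * 'd V x (delta_mx i 0)).
  by apply/funext => y; rewrite diff_coordE.
apply: continuous_big => [|i _ x]; first exact: add_continuous.
have cfi : {for x, continuous (fun y => f y i 0)}.
  exact: (continuous_comp (cf x) (@coord_continuous _ _ _ i 0 (f x))).
exact: (continuousM cfi (cdV (delta_mx i 0) x)).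
Qed.

Lemma mean_value_segment V y z : (forall x, differentiable V x) ->
  exists2 t : R, 0 <= t <= 1 & V z - V y = 'd V (y + t *: (z - y)) (z - y).
Proof.
move=> dV; pose g (t : R) := y + t *: (z - y).
have dg t : is_derive t (1 : R) g (z - y).
  apply/is_derive_colP => i.
  have -> : (fun s => g s i 0) = cst (y i 0) + (z i 0 - y i 0) \*: id.
    by apply/funext => s; rewrite /g !mxE mulrC.
  by apply: is_derive_eq; rewrite !mxE add0r [LHS]mulr1.
have dVg t : is_derive t (1 : R) (V \o g) ('d V (g t) (z - y)).
  exact: is_derive_comp_diff.
have [||t t01] := @MVT_segment R (V \o g) (fun t => 'd V (g t) (z - y)) 0 1 => //.
  apply: continuous_subspaceT => t.
  by apply: differentiable_continuous; apply/derivable1_diffP; have [] := dVg t.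
rewrite /= /g scale1r scale0r addr0 [y + (z - y)]addrC subrK subr0 mulr1 => ->.
by exists t; rewrite // -in_itv.
Qed.

Lemma C1_locally_klipschitz V x : C1 V ->
  exists r L : R, [/\ 0 < r, 0 <= L & L.-lipschitz_(ball x r) V].
Proof.
move=> [dV cdV]; pose S y := \sum_i `|'d V y (delta_mx i 0)|.
have cS : continuous S.
  apply: continuous_big => [|i _ y]; first exact: add_continuous.
  exact: (continuous_comp (cdV _ y) (@norm_continuous _ _ _)).
have /nbhs_ballP[r /= r0 Sr] : \forall y \near x, S y < S x + 1.
  by apply: (cS x _ (lt_nbhsl _)); rewrite ltrDl.
exists r, (S x + 1); split => //; first by rewrite addr_ge0 // sumr_ge0.
apply/klipschitzP => y z yr zr.
have [t t01 ->] := mean_value_segment z y dV.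
apply: le_trans (diff_norm_le _ _ _) _; rewrite ler_wpM2r //.
by apply/ltW/Sr; exact: ball_segment.
Qed.

Lemma abs_cont_C1_comp V g (a b : R) :
  C1 V -> a <= b -> abs_cont g a b -> abs_cont (V \o g) a b.
Proof.
move=> VC1 ab acg; apply: abs_cont_local => // x axb.
have [r [L [r0 L0 /klipschitzP lipV]]] := C1_locally_klipschitz (g x) VC1.
apply: (straddling_near (abs_cont_near acg r0 axb)).
move=> y z /andP[ay yx] /andP[xz zb] gr.
have acgyz := abs_cont_sub ay zb acg.
apply: (abs_cont_dominated (L := L) acgyz acgyz) => s t ys st tz.
have ball_g u : y <= u -> u <= z -> ball (g x) r (g u).
  move=> yu uz; rewrite -ball_normE /= distrC gr ?yu //.
  by rewrite (le_trans ay) // (le_trans uz).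
have ball_gs := ball_g s ys (le_trans st tz).
have ball_gt := ball_g t (le_trans ys st) tz.
apply: le_trans (lipV _ _ ball_gt ball_gs) _.
by apply: ler_wpM2l; rewrite ?lerDl.
Qed.

End ContinuouslyDifferentiable.

(** * Picard iteration *)

Lemma itv_common_point (R : realType) (I : Type) (P : set I) (u r : I -> R) :
  P !=set0 -> (forall i j, P i -> P j -> `|u i - u j| <= r i + r j) ->
  exists l, forall i, P i -> `|l - u i| <= r i.
Proof.
move=> [i0 Pi0] ur; pose E := [set u i - r i | i in P].
have ubE i : P i -> ubound E (u i + r i).
  by move=> Pi _ [j Pj <-]; have := ur j i Pj Pi; rewrite ler_norml => /andP[_]; lra.
have E0 : E !=set0 by exists (u i0 - r i0), i0.
exists (sup E) => i Pi; rewrite ler_distl; apply/andP; split.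
  by apply: ub_le_sup; [exists (u i + r i); exact: ubE|exists i].
by apply: ge_sup => //; exact: ubE.
Qed.

(* Helly's theorem for the balls of the supremum norm. It yields the limit of a
   Cauchy sequence as well as the extension of a Lipschitz function to an
   endpoint of its domain, [r] being the distance still to be covered. *)
Lemma closed_balls_common_point (R : realType) (N : nat) (I : Type) (P : set I)
    (u : I -> 'cV[R]_N) (r : I -> R) :
  P !=set0 -> (forall i j, P i -> P j -> `|u i - u j| <= r i + r j) ->
  exists l, forall i, P i -> `|l - u i| <= r i.
Proof.
move=> P0 ur.
have r0 i : P i -> 0 <= r i.
  by move=> Pi; have := ur i i Pi Pi; rewrite subrr normr0; lra.
have /choice[l lr] (a : 'I_N) : exists l, forall i, P i -> `|l - u i a 0| <= r i.
  apply: itv_common_point => // i j Pi Pj; apply: le_trans (ur i j Pi Pj).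
  by have := coord_le_norm (u i - u j) a; rewrite !mxE.
exists (\col_a l a) => i Pi; apply: norm_le_coord => [|a]; first exact: r0.
by rewrite !mxE; exact: lr.
Qed.

Section FunctionContraction.
Variables (R : realType) (N : nat) (q : R).
Hypotheses (q0 : 0 <= q) (q1 : q < 1).

Lemma exists_geometric_le (C e : R) : 0 < e -> exists k, C * q ^+ k <= e.
Proof.
move=> e0; have norm_q_lt1 : `|q| < 1 by rewrite ger0_norm.
have /cvgrPdist_le/(_ e e0)[k _ /(_ k (leqnn k))] := cvg_geometric C norm_q_lt1.
by rewrite sub0r normrN => Ck; exists k; exact: le_trans (ler_norm _) Ck.
Qed.

Lemma geometric_steps_limit (Y : nat -> 'cV[R]_N) D :
  (forall k, `|Y k.+1 - Y k| <= D * q ^+ k) ->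
  exists l, forall k, `|l - Y k| <= D / (1 - q) * q ^+ k.
Proof.
move=> step; pose r k := D / (1 - q) * q ^+ k.
have D0 : 0 <= D by have := step 0%N; rewrite expr0 mulr1; exact: le_trans.
have r0 k : 0 <= r k by rewrite mulr_ge0 ?exprn_ge0 // divr_ge0 // subr_ge0 ltW.
have stepE k : D * q ^+ k = r k - r k.+1.
  by rewrite /r exprS; field; rewrite gt_eqF // subr_gt0.
have far k i : `|Y (k + i)%N - Y k| <= r k - r (k + i)%N.
  elim: i => [|i IH]; first by rewrite addn0 !subrr normr0.
  rewrite addnS; apply: le_trans (ler_distD (Y (k + i)%N) _ _) _.
  by have := step (k + i)%N; rewrite stepE; lra.
have [|k l _ _|l lY] := closed_balls_common_point (P := setT) (u := Y) (r := r).
- by exists 0%N.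
- wlog kl : k l / (k <= l)%N.
    by move=> ord; have [/ord//|/ltnW/ord] := leqP k l; rewrite distrC [r l + _]addrC.
  rewrite distrC -(subnKC kl); apply: le_trans (far _ _) _.
  by rewrite lerD2l (le_trans _ (r0 _)) // oppr_le0.
- by exists l => k; exact: lY.
Qed.

Variable I : Type.
Implicit Types (y z : I -> 'cV[R]_N) (P : set (I -> 'cV[R]_N)).

Definition uniformly_closed P : Prop := forall y,
  (forall e, 0 < e -> exists2 z, P z & forall i, `|y i - z i| <= e) -> P y.

Lemma fun_contraction_fixpoint P (T : (I -> 'cV[R]_N) -> I -> 'cV[R]_N) y0 D :
  uniformly_closed P -> P y0 -> (forall y, P y -> P (T y)) ->
  (forall i, `|T y0 i - y0 i| <= D) ->
  (forall y z d, P y -> P z -> (forall i, `|y i - z i| <= d) ->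
     forall i, `|T y i - T z i| <= q * d) ->
  exists2 y, P y & T y = y.
Proof.
move=> Pclosed Py0 PT Ty0 contr; pose Y k := iter k T y0.
have PY k : P (Y k) by elim: k => //= k; exact: PT.
have step k i : `|Y k.+1 i - Y k i| <= D * q ^+ k.
  elim: k i => [|k IH] i; first by rewrite expr0 mulr1; exact: Ty0.
  by rewrite exprS mulrCA; exact: contr (PY k.+1) (PY k) IH i.
have /choice[y yY] i := geometric_steps_limit (fun k => step k i).
have Py : P y.
  apply: Pclosed => e e0; have [k ke] := exists_geometric_le (D / (1 - q)) e0.
  by exists (Y k) => // i; exact: le_trans (yY i k) ke.
exists y => //; apply/funext => i; apply/eqP; rewrite -subr_eq0 -normr_le0.
apply/ler_addgt0Pl => e e0; rewrite addr0; have e20 : 0 < e / 2 by lra.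
have [k ke] := exists_geometric_le (q * (D / (1 - q))) e20.
apply: le_trans (ler_distD (Y k.+1 i) _ _) _; rewrite [e]splitr.
apply: lerD; apply: le_trans ke; rewrite -mulrA.
  by apply: contr => // j; exact: yY.
by rewrite distrC mulrCA -exprS.
Qed.

End FunctionContraction.

Section Primitive.
Variables (R : realType) (N : nat) (T : R).
Implicit Types (g : R -> 'cV[R]_N) (s t h : R).

(* Integrating from [T - 1] makes [T] an interior point, so that the primitive
   is differentiable there. *)
Definition primitive g t : 'cV[R]_N :=
  \col_i (\int[@lebesgue_measure R]_(s in `[T - 1, t]) (g s i 0) -
          \int[@lebesgue_measure R]_(s in `[T - 1, T]) (g s i 0)).

Lemma primitive_start g : primitive g T = 0.
Proof. by apply/colP => i; rewrite !mxE subrr. Qed.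

Lemma is_derive_primitive g t :
  continuous g -> T <= t -> is_derive t 1 (primitive g) (g t).
Proof.
move=> cg Tt; apply/is_derive_colP => i.
have cgi : continuous (fun s => g s i 0).
  by move=> s; exact: (continuous_comp (cg s) (@coord_continuous _ _ _ i 0 (g s))).
pose F s := \int[@lebesgue_measure R]_(r in `[T - 1, s]) (g r i 0).
have [||||dF F'] := @continuous_FTC1_closed R (fun s => g s i 0) (T - 1) t (t + 1).
- lra.
- apply: continuous_compact_integrable; first exact: segment_compact.
  exact: continuous_subspaceT.
- lra.
- exact: cgi.
have -> : (fun s => primitive g s i 0) = F - cst (F T).
  by apply/funext => s; rewrite mxE.
have dFi : is_derive t 1 F (g t i 0).
  exact: (DeriveDef dF (etrans (esym (derive1E _ _)) F')).
by apply: is_derive_eq; rewrite subr0.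
Qed.

Lemma primitive_klipschitz g h M : continuous g -> (forall t, `|g t| <= M) ->
  M.-lipschitz_`[T, h] (primitive g).
Proof.
move=> cg gM; apply: is_derive_col_klipschitz (fun t _ => gM t) => t /andP[Tt _].
exact: is_derive_primitive.
Qed.

Lemma primitive_dist_le g1 g2 t d : continuous g1 -> continuous g2 -> T <= t ->
  (forall s, `|g1 s - g2 s| <= d) ->
  `|primitive g1 t - primitive g2 t| <= d * (t - T).
Proof.
move=> cg1 cg2 Tt g12.
have dg s : T <= s <= t -> is_derive s 1 (primitive g1 - primitive g2) (g1 s - g2 s).
  move=> /andP[Ts _]; have d1 := is_derive_primitive cg1 Ts.
  by have d2 := is_derive_primitive cg2 Ts; exact: is_deriveB.
have /klipschitz_monotoneP/(_ T t) := is_derive_col_klipschitz dg (fun s _ => g12 s).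
by rewrite !fctE !primitive_start subrr subr0 /= !in_itv /= !lexx Tt; apply.
Qed.

End Primitive.

Lemma clamp_klipschitz (R : realType) (u v : R) :
  1.-lipschitz (fun s : R => Num.max u (Num.min s v) : R).
Proof.
apply/klipschitz_monotoneP => s t _ _ st; rewrite mul1r.
have min_le : Num.min s v <= Num.min t v by rewrite le_min !ge_min st lexx orbT.
rewrite ger0_norm; last by rewrite subr_ge0 ge_max !le_max min_le lexx orbT.
have max_ge_u : u <= Num.max u (Num.min s v) by rewrite le_max lexx.
have max_ge_min : Num.min s v <= Num.max u (Num.min s v) by rewrite le_max lexx orbT.
move: (Num.max u (Num.min s v)) max_ge_u max_ge_min => m um minm.
rewrite lerBlDr ge_max; apply/andP; split; first by lra.
by move: minm; have [sv|vs] := leP s v => minm; have [tv|vt] := leP t v; lra.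
Qed.

Section Picard.
Variables (R : realType) (N : nat) (f : 'cV[R]_N -> 'cV[R]_N) (L h T : R).
Variable x0 : 'cV[R]_N.
Hypotheses (lipf : L.-lipschitz f) (h0 : 0 <= h) (L0 : 0 <= L) (hL : h * L < 1).

Let clamp (t : R) : R := Num.max T (Num.min t (T + h)).

Let clamp_itv t : T <= clamp t <= T + h.
Proof. by rewrite /clamp le_max lexx ge_max ge_min lexx orbT andbT lerDl. Qed.

Let clampE t : T <= t <= T + h -> clamp t = t.
Proof. by move=> /andP[t0 th]; rewrite /clamp min_l // max_r. Qed.

Let M := `|f x0| / (1 - h * L).

Let M0 : 0 <= M.
Proof. by rewrite divr_ge0 // subr_ge0 ltW. Qed.

Definition picard (y : R -> 'cV[R]_N) (t : R) : 'cV[R]_N :=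
  x0 + primitive T (f \o y) (clamp t).

(* [M] solves [M = |f x0| + L * (M * h)], hence bounds [f] on the ball of radius
   [M * h] around [x0]. *)
Let picard_domain : set (R -> 'cV[R]_N) :=
  [set y | M.-lipschitz y /\ forall t, `|y t - x0| <= M * h].

Let f_comp_continuous y : picard_domain y -> continuous (f \o y).
Proof.
move=> [lipy _] t.
by apply: continuous_comp; [exact: klipschitz_continuous lipy t|
                            exact: klipschitz_continuous lipf (y t)].
Qed.

Let f_comp_le y t : picard_domain y -> `|f (y t)| <= M.
Proof.
move=> [_ /(_ t) yx0]; rewrite -[f (y t)](subrK (f x0)).
apply: le_trans (ler_normD _ _) _.
have /klipschitzP/(_ (y t) x0 I I) fy := lipf.
have step_le : L * `|y t - x0| <= L * (M * h) by rewrite ler_wpM2l.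
have ME : M = `|f x0| + L * (M * h) by rewrite /M; field; rewrite gt_eqF // subr_gt0.
by rewrite ME; lra.
Qed.

Let picard_domain_stable y : picard_domain y -> picard_domain (picard y).
Proof.
move=> Py; have cf := f_comp_continuous Py.
have /klipschitzP lipF : M.-lipschitz_`[T, T + h] (primitive T (f \o y)).
  by apply: primitive_klipschitz => // t; exact: f_comp_le.
have clampI t : `[T, T + h]%classic (clamp t) by rewrite /= in_itv /= clamp_itv.
split=> [|t].
  apply/klipschitzP => s t _ _; rewrite /picard opprD addrACA subrr add0r.
  apply: le_trans (lipF _ _ (clampI s) (clampI t)) _; rewrite ler_wpM2l //.
  by have /klipschitzP/(_ s t I I) := clamp_klipschitz T (T + h); rewrite mul1r.
rewrite /picard addrC addKr -[X in `|X|]subr0 -[X in _ - X](primitive_start T (f \o y)).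
have TI : `[T, T + h]%classic T by rewrite /= in_itv /= lexx lerDl.
apply: le_trans (lipF _ _ (clampI t) TI) _; rewrite ler_wpM2l //.
by have /andP[Tt tTh] := clamp_itv t; rewrite ger0_norm ?subr_ge0 // lerBlDl.
Qed.

Let picard_contraction y z d : picard_domain y -> picard_domain z ->
  (forall t, `|y t - z t| <= d) -> forall t, `|picard y t - picard z t| <= h * L * d.
Proof.
move=> Py Pz yzd t; rewrite /picard opprD addrACA subrr add0r.
have /andP[Tt tTh] := clamp_itv t.
have fyz s : `|f (y s) - f (z s)| <= L * d.
  have /klipschitzP/(_ (y s) (z s) I I) := lipf; move/le_trans; apply.
  by rewrite ler_wpM2l.
have := primitive_dist_le (f_comp_continuous Py) (f_comp_continuous Pz) Tt fyz.
move/le_trans; apply.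
have d0 : 0 <= d by apply: le_trans (yzd T).
by rewrite -mulrA mulrC ler_wpM2r ?mulr_ge0 // lerBlDl.
Qed.

Let picard_domain_closed : uniformly_closed picard_domain.
Proof.
move=> y appr; split=> [|t].
  apply/klipschitzP => s t _ _; apply/ler_addgt0Pr => e e0.
  have e20 : 0 < e / 2 by lra.
  have [z [/klipschitzP/(_ s t I I) lipz _] yz] := appr _ e20.
  apply: le_trans (ler_distD (z s) _ _) _.
  have := ler_distD (z t) (z s) (y t); have := yz s; have := yz t.
  by rewrite [`|y t - _|]distrC; lra.
apply/ler_addgt0Pr => e e0; have [z [_ zx0] yz] := appr e e0.
apply: le_trans (ler_distD (z t) _ _) _.
by have := yz t; have := zx0 t; lra.
Qed.

Theorem picard_lindelof : exists y : R -> 'cV[R]_N,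
  [/\ y T = x0, M.-lipschitz y &
      forall t, T < t < T + h -> is_derive t 1 y (f (y t))].
Proof.
have P0 : picard_domain (cst x0).
  split=> [|t]; last by rewrite subrr normr0 mulr_ge0.
  by apply/klipschitzP => s t _ _; rewrite subrr normr0 mulr_ge0.
have [y Py yE] := fun_contraction_fixpoint (mulr_ge0 h0 L0) hL picard_domain_closed
  P0 picard_domain_stable (picard_domain_stable P0).2 picard_contraction.
have yE' t : T <= t <= T + h -> y t = x0 + primitive T (f \o y) t.
  by move=> tI; rewrite -[in LHS]yE /picard clampE.
exists y; split; [|by case: Py|move=> t /andP[Tt tTh]].
  by rewrite yE' ?lexx ?lerDl // primitive_start addr0.
have dF := is_derive_primitive (f_comp_continuous Py) (ltW Tt).
have dy : is_derive t 1 (cst x0 + primitive T (f \o y)) (f (y t)).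
  by apply: is_derive_eq; rewrite add0r.
apply: near_eq_is_derive dy => //.
by apply: filterS2 (lt_nbhsr Tt) (lt_nbhsl tTh) => s Ts sTh; rewrite yE' ?ltW.
Qed.

End Picard.

(** * Hybrid time domains *)

Section HybridTimeDomains.
Variable R : realType.
Implicit Types (E : set (R * nat)) (t : nat -> R) (s T : R) (j k J : nat).

Definition slice E j : set R := [set s | E (s, j)].

Definition truncation E T J : set (R * nat) :=
  E `&` [set p | p.1 <= T /\ (p.2 <= J)%N].

Definition staircase t J : set (R * nat) :=
  [set p | (p.2 <= J)%N /\ t p.2 <= p.1 <= t p.2.+1].

Definition time_ordered E : Prop :=
  forall s k T J, E (s, k) -> E (T, J) -> (k < J)%N -> s <= T.

Definition top_level E J : Prop :=
  slice E J !=set0 /\ forall s k, E (s, k) -> (k <= J)%N.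

Lemma hybrid_time_domainP E : hybrid_time_domain E <->
  forall T J, E (T, J) -> exists t,
    [/\ t 0%N = 0, forall j, (j <= J)%N -> t j <= t j.+1 &
        truncation E T J = staircase t J].
Proof.
split=> hE T J ETJ; have [t [t0 tS tE]] := hE T J ETJ; exists t; split=> //.
  apply/seteqP; split=> -[s k] /=; last by move=> [kJ /andP[ts st]]; apply/(tE s k).
  move=> [Esk sTkJ]; have [kJ [ts st]] := (tE s k).1 (conj Esk sTkJ).
  by split; rewrite //= ts.
move=> s k; rewrite -[E (s, k) /\ _ /\ _]/(truncation E T J (s, k)) tE.
by split=> [[kJ /andP[]]|[kJ [ts st]]] //; split; rewrite //= ts.
Qed.

Lemma staircase_end E t T J : E (T, J) -> t J <= t J.+1 ->
  truncation E T J = staircase t J -> t J.+1 = T.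
Proof.
move=> ETJ tJ tE; apply/eqP; rewrite eq_le; apply/andP; split.
  have : truncation E T J (t J.+1, J) by rewrite tE; split; rewrite //= tJ lexx.
  by move=> [_ []].
have : truncation E T J (T, J) by split=> /=.
by rewrite tE => -[_ /andP[]].
Qed.

Lemma slice_interval E j : hybrid_time_domain E -> is_interval (slice E j).
Proof.
move=> /hybrid_time_domainP hE a b Ea Eb s /andP[as_ sb].
have [t [_ _ tE]] := hE b j Eb.
have [_ /andP[_ bt]] : staircase t j (b, j) by rewrite -tE; split=> /=.
have [_ /andP[ta _]] : staircase t j (a, j).
  by rewrite -tE; split; rewrite //= (le_trans as_).
have [//] : truncation E b j (s, j).
by rewrite tE; split; rewrite //= (le_trans ta) // (le_trans sb).
Qed.

Lemma hybrid_time_ind E (P : R -> nat -> Prop) : hybrid_time_domain E -> P 0 0%N ->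
  (forall s T j, E (s, j) -> E (T, j) -> s <= T -> P s j -> P T j) ->
  (forall T j, E (T, j) -> E (T, j.+1) -> P T j -> P T j.+1) ->
  forall T j, E (T, j) -> P T j.
Proof.
move=> /hybrid_time_domainP hE P0 flow jump T J ETJ; have [t [t0 tS tE]] := hE _ _ ETJ.
have tP s k : (k <= J)%N -> t k <= s <= t k.+1 -> E (s, k).
  by move=> kJ ts; have [] : truncation E T J (s, k) by rewrite tE.
have El k : (k <= J)%N -> E (t k, k) by move=> kJ; apply: tP; rewrite ?lexx ?tS.
have Er k : (k <= J)%N -> E (t k.+1, k) by move=> kJ; apply: tP; rewrite ?lexx ?tS.
have Pk k : (k <= J)%N -> P (t k) k.
  elim: k => [|k IH] kJ; first by rewrite t0.
  have kJ' := ltnW kJ; apply: jump; [exact: Er|exact: El|].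
  by apply: (flow (t k)); [exact: El|exact: Er|exact: tS|exact: IH].
rewrite -(staircase_end ETJ (tS _ (leqnn J)) tE).
by apply: (flow (t J)); [exact: El|exact: Er|exact: tS|exact: Pk].
Qed.

Lemma hybrid_time_ge0 E s j : hybrid_time_domain E -> E (s, j) -> 0 <= s.
Proof.
move=> hE; apply: (hybrid_time_ind (P := fun s _ => 0 <= s) hE) => // r T k _ _ rT r0.
exact: le_trans rT.
Qed.

Lemma jump_time E T k J : hybrid_time_domain E -> E (T, J) -> (k < J)%N ->
  exists r, [/\ E (r, k), E (r, k.+1) & r <= T].
Proof.
move=> /hybrid_time_domainP hE ETJ kJ; have [t [_ tS tE]] := hE _ _ ETJ.
have t_r : truncation E T J (t k.+1, k.+1) by rewrite tE; split; rewrite //= lexx tS.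
have [Er _] : truncation E T J (t k.+1, k).
  by rewrite tE; split; rewrite /= ?lexx ?(ltnW kJ) // tS // ltnW.
by exists (t k.+1); case: t_r => Er' [rT _].
Qed.

Lemma bounded_top_level E b : hybrid_time_domain E -> E (0, 0%N) ->
  (forall s j, E (s, j) -> s + j%:R <= b) -> exists J, top_level E J.
Proof.
move=> hE E00 Eb.
have le_bound j : slice E j !=set0 -> (j <= Num.bound b)%N.
  move=> [s Es]; have s0 := hybrid_time_ge0 hE Es; have sjb := Eb _ _ Es.
  rewrite -(ler_nat R); apply: le_trans (_ : b <= _); first by lra.
  by apply/ltW/archi_boundP; have := Eb _ _ E00; rewrite add0r.
have exE : exists j, `[< slice E j !=set0 >].
  by exists 0%N; apply/asboolP; exists 0.
have [|J /asboolP EJ maxJ] := ex_maxnP exE (m := Num.bound b).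
  by move=> j /asboolP; exact: le_bound.
by exists J; split=> // s k Esk; apply: maxJ; apply/asboolP; exists s.
Qed.

Definition hold_after t j T : nat -> R := fun k => if (k <= j)%N then t k else T.

Lemma hold_after_step_le t j T : (forall k, (k < j)%N -> t k <= t k.+1) -> t j <= T ->
  forall k, (k <= j)%N -> hold_after t j T k <= hold_after t j T k.+1.
Proof.
move=> tS tT k kj; rewrite /hold_after kj; case: ifPn => [|]; first exact: tS.
by rewrite -leqNgt => jk; have -> : k = j by apply/eqP; rewrite eqn_leq kj.
Qed.

Lemma staircase_prolong t J T : t J <= t J.+1 <= T ->
  staircase (hold_after t J T) J =
  staircase t J `|` [set p | p.2 = J /\ t J.+1 <= p.1 <= T].
Proof.
move=> /andP[tJ tT]; rewrite /hold_after /staircase; apply/seteqP; split=> -[s k] /=.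
  move=> [kJ]; rewrite kJ ltn_neqAle kJ andbT.
  have [-> /andP[ts sT]|_ ts] := eqVneq k J; last by left.
  by have [st|/ltW ts'] := leP s (t J.+1); [left; rewrite ts|right; rewrite ts'].
move=> [[kJ /andP[ts st]]|[-> /andP[ts sT]]]; last first.
  by rewrite leqnn ltnn sT (le_trans tJ).
rewrite kJ ltn_neqAle kJ andbT ts; split=> //=.
by have [kE|_] := eqVneq k J; rewrite //= (le_trans st) // kE.
Qed.

Lemma staircase_add_step t J T :
  staircase (hold_after t J.+1 T) J.+1 =
  staircase t J `|` [set p | p.2 = J.+1 /\ t J.+1 <= p.1 <= T].
Proof.
rewrite /hold_after /staircase; apply/seteqP; split=> -[s k] /=.
  rewrite ltnS => -[kJ]; rewrite kJ; have [kJ'|Jk] := leqP k J; first by left.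
  by have -> : k = J.+1; [apply/eqP; rewrite eqn_leq kJ|right].
move=> [[kJ ts]|[-> ts]]; rewrite ?leqnn ?ltnn //.
by rewrite ltnS kJ leqW.
Qed.

Lemma hybrid_time_domain_prolong E J T1 T2 :
  hybrid_time_domain E -> time_ordered E -> top_level E J -> E (T1, J) ->
  hybrid_time_domain (E `|` [set p | p.2 = J /\ T1 <= p.1 <= T2]).
Proof.
move=> hE ord [_ topJ] ET1 /=; have sliceJ := @slice_interval _ J hE.
move: (hE); rewrite !hybrid_time_domainP => hE' T J' [ETJ|[/= -> /andP[T1T TT2]]].
  have [t [t0 tS tE]] := hE' T J' ETJ; exists t; split=> //; rewrite -tE.
  apply/seteqP; split=> -[s k] [Esk [/= sT kJ']]; split=> //; last by left.
  case: Esk => [//|[/= kJ /andP[T1s _]]]; rewrite kJ in kJ' *.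
  have J'E : J' = J by apply/eqP; rewrite eqn_leq kJ' (topJ T).
  by apply: (sliceJ T1 T) => //; [rewrite -J'E|rewrite T1s].
have [t [t0 tS tE]] := hE' T1 J ET1.
have tJ := tS J (leqnn J); have tJ1 := staircase_end ET1 tJ tE.
exists (hold_after t J T); split=> //.
  apply: hold_after_step_le => [j /ltnW/tS//|].
  by rewrite (le_trans tJ) // tJ1.
rewrite staircase_prolong ?tJ ?tJ1 // -tE; apply/seteqP; split=> -[s k] /=.
  move=> [Esk [/= sT kJ]]; case: Esk => [Esk|[/= -> /andP[T1s _]]]; last first.
    by right; rewrite T1s.
  have [sT1|T1s] := leP s T1; first by left.
  right; rewrite (ltW T1s) sT; split=> //; apply/eqP; rewrite eqn_leq kJ leqNgt.
  by apply/negP => /(ord _ _ _ _ Esk ET1); rewrite leNgt T1s.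
move=> [[Esk [/= sT1 kJ]]|[-> /andP[T1s sT]]].
  by split; [left|split; rewrite //= (le_trans sT1)].
by split; [right; rewrite /= T1s (le_trans sT)|split].
Qed.

Lemma hybrid_time_domain_jump E J T :
  hybrid_time_domain E -> top_level E J -> E (T, J) ->
  hybrid_time_domain (E `|` [set p | p.2 = J.+1 /\ T <= p.1 <= T]).
Proof.
move=> hE [_ topJ] ETJ; move: (hE); rewrite !hybrid_time_domainP => hE' T' J'.
move=> [ETJ'|[/= -> /le_anti TT']].
  have [t [t0 tS tE]] := hE' T' J' ETJ'; exists t; split=> //; rewrite -tE.
  apply/seteqP; split=> -[s k] [Esk [/= sT kJ']]; split=> //; last by left.
  case: Esk => [//|[/= kJ _]].
  by have := leq_trans kJ' (topJ _ _ ETJ'); rewrite kJ ltnn.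
rewrite -TT' {TT'}; have [t [t0 tS tE]] := hE' T J ETJ.
have tJ1 := staircase_end ETJ (tS J (leqnn J)) tE.
exists (hold_after t J.+1 T); split=> //.
  by apply: hold_after_step_le => [j|]; [exact: tS|rewrite tJ1].
rewrite staircase_add_step tJ1 -tE; apply/seteqP; split=> -[s k] /=.
  move=> [[Esk|[/= -> TsT]] [/= sT kJ]]; last by right.
  by left; split=> //; split=> //=; exact: topJ Esk.
move=> [[Esk [/= sT kJ]]|[-> /le_anti <-]].
  by split; [left|split; rewrite //= leqW].
by split; [right; rewrite /= lexx|split=> /=].
Qed.

End HybridTimeDomains.

(** * Flows and solutions *)

Lemma lebesgue_ae_neq (R : realType) (a : R) :
  \forall t \ae (@lebesgue_measure R), t <> a.
Proof.
exists [set a]; split => //; first exact: lebesgue_measure_set1.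
by move=> t /=; apply: contrapT.
Qed.

Lemma interior_gt (R : realType) (A : set R) t : interior A t -> exists2 s, t < s & A s.
Proof.
move=> /nbhs_ballP[e /= e0 eA]; exists (t + e / 2); first by rewrite ltrDl divr_gt0.
apply: eA; rewrite /ball /= opprD addrA subrr sub0r normrN.
by rewrite gtr0_norm ?divr_gt0 //; lra.
Qed.

Section Flows.
Variables (R : realType) (N : nat).
Implicit Types (C : set 'cV[R]_N) (f : 'cV[R]_N -> 'cV[R]_N) (g y : R -> 'cV[R]_N).
Implicit Types (I : set R) (a b c t T M : R).

Definition flow_on C f I g : Prop :=
  [/\ loc_abs_cont_on g I, forall t, interior I t -> C (g t) &
      \forall t \ae (@lebesgue_measure R), I t -> is_derive t 1 g (f (g t))].

Lemma flow_onS C f I J g : J `<=` I -> flow_on C f I g -> flow_on C f J g.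
Proof.
move=> JI [acg Cg dg]; split=> [a b Ja Jb|t Jt|]; first by apply: acg; exact: JI.
  by apply: Cg; apply: interiorS Jt.
by apply: filterS dg => t dg /JI.
Qed.

Lemma flow_on_abs_cont C f g a b : a <= b -> flow_on C f `[a, b] g -> abs_cont g a b.
Proof. by move=> ab [acg _ _]; apply: acg; rewrite //= in_itv /= lexx ?andbT. Qed.

Lemma klipschitz_loc_abs_cont I g M :
  is_interval I -> M.-lipschitz_I g -> loc_abs_cont_on g I.
Proof.
move=> itvI /klipschitzP lipg a b Ia Ib _.
apply: (@klipschitz_abs_cont _ _ _ _ _ M); apply/klipschitzP => s t.
by rewrite /= !in_itv /= => sab tab; apply: lipg; exact: (itvI a b).
Qed.

Lemma klipschitz_flow_exists f L h T x :
  L.-lipschitz f -> 0 <= L -> 0 <= h -> h * L < 1 ->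
  exists2 y, y T = x & flow_on setT f `[T, T + h] y.
Proof.
move=> lipf L0 h0 hL.
have [y [yT /klipschitzP lipy dy]] := picard_lindelof T x lipf h0 L0 hL.
exists y => //; split=> [|//|].
  apply: klipschitz_loc_abs_cont; first exact: interval_is_interval.
  by apply/klipschitzP => s t _ _; exact: lipy.
apply: filterS2 (lebesgue_ae_neq T) (lebesgue_ae_neq (T + h)) => t tT tTh.
rewrite /= in_itv /= => /andP[Tt t_le]; apply: dy.
by rewrite !lt_neqAle Tt t_le !andbT; apply/andP; split; apply/eqP => // /esym.
Qed.

Lemma flow_on_klipschitz C f I g M : is_interval I -> flow_on C f I g ->
  (forall t, I t -> `|f (g t)| <= M) -> M.-lipschitz_I g.
Proof.
move=> itvI [acg _ dg] fM; apply/klipschitz_monotoneP => s t Is It st.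
have /klipschitz_monotoneP/(_ s t) : M.-lipschitz_`[s, t] g.
  apply: abs_cont_ae_klipschitz; [exact: acg| |exact: le_trans (fM s Is)].
  apply: filterS dg => r dg str; have Ir : I r by exact: (itvI s t).
  by exists (f (g r)); [exact: dg|exact: fM].
by rewrite /= !in_itv /= !lexx st; apply.
Qed.

Lemma flow_on_set1 C f c g : flow_on C f [set c] g.
Proof.
split=> [a b -> ->|t ct|].
- move=> _; apply: (@klipschitz_abs_cont _ _ _ _ _ 0); apply/klipschitzP => s t /=.
  rewrite !in_itv /= => /le_anti<- /le_anti<-.
  by rewrite subrr normr0 mul0r.
- have [s ts /= sc] := interior_gt ct; move: ts.
  by rewrite sc (interior_subset ct) ltxx.
- by apply: filterS (lebesgue_ae_neq c) => t.
Qed.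

Lemma flow_on_cat C f I g y b c :
  I c -> (forall t, I t -> t <= c) -> c <= b -> y c = g c -> C (g c) ->
  flow_on C f I g -> flow_on C f `[c, b] y ->
  flow_on C f (I `|` `[c, b]) (fun t => if t < c then g t else y t).
Proof.
move=> Ic Ile cb ycg Cgc [acg Cg dg] [acy Cy dy]; set z := fun t => _.
have zl t : t < c -> z t = g t by rewrite /z => ->.
have zr t : c <= t -> z t = y t by rewrite /z ltNge => ->.
have Ul t : (I `|` `[c, b]) t -> t <= c -> I t.
  by move=> [//|]; rewrite /= in_itv /= => /andP[ct _] tc; rewrite (_ : t = c) //; lra.
have Ur t : (I `|` `[c, b]) t -> c <= t -> t <= b.
  by move=> [/Ile tc _|]; [exact: le_trans cb|rewrite /= in_itv /= => /andP[]].
have acl a : I a -> abs_cont z a c.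
  move=> Ia; have acgl : abs_cont g a c by apply: acg => //; exact: Ile.
  apply: (eq_abs_cont _ acgl) => t /andP[_].
  by rewrite le_eqVlt => /orP[/eqP->|/zl//]; rewrite zr.
have acr t : c <= t -> t <= b -> abs_cont z c t.
  move=> ct tb.
  have acyr : abs_cont y c t by apply: acy; rewrite //= in_itv /= ?lexx ?ct.
  by apply: (eq_abs_cont _ acyr) => r /andP[cr _]; rewrite zr.
split.
- move=> s t Us Ut st; have [tc|/ltW ct] := leP t c.
    by apply: abs_cont_sub (lexx s) tc (acl s (Ul s Us (le_trans st tc))).
  have [cs|/ltW sc] := leP c s.
    exact: abs_cont_sub cs (lexx t) (acr t ct (Ur t Ut ct)).
  by apply: (abs_cont_cat sc ct); [exact/acl/Ul|exact/acr/Ur].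
- move=> t Ut; have [tc|ct|tE] := ltgtP t c; last by rewrite tE zr // ycg.
    rewrite zl //; apply: Cg; rewrite /interior.
    by apply: filterS2 Ut (lt_nbhsl tc) => s Us /ltW; exact: Ul.
  rewrite zr ?ltW //; apply: Cy; rewrite /interior.
  apply: filterS2 Ut (lt_nbhsr ct) => s Us /ltW cs.
  by rewrite /= in_itv /= cs Ur.
- apply: filterS3 dg dy (lebesgue_ae_neq c) => t dg dy tc Ut.
  have [ltc|ct|//] := ltgtP t c.
    rewrite zl //; apply: near_eq_is_derive (dg (Ul t Ut (ltW ltc))) => //.
    by apply: filterS (lt_nbhsl ltc) => s sc; rewrite zl.
  rewrite zr ?ltW //; apply: near_eq_is_derive (dy _) => //.
    by apply: filterS (lt_nbhsr ct) => s cs; rewrite zr // ltW.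
  by rewrite /= in_itv /= ltW // Ur // ltW.
Qed.

Lemma klipschitz_extend_end I g T M :
  I !=set0 -> (forall t, I t -> t < T) -> 0 <= M -> M.-lipschitz_I g ->
  exists l, M.-lipschitz_(I `|` [set T]) (fun t => if t < T then g t else l).
Proof.
move=> I0 ltT M0 lipg.
have [//|s t Is It|l lg] :=
    closed_balls_common_point (P := I) (u := g) (r := fun t => M * (T - t)).
  have /klipschitzP/(_ s t Is It)/le_trans := lipg; apply.
  rewrite -mulrDr ler_wpM2l // ler_norml.
  by have := ltT s Is; have := ltT t It; lra.
exists l; apply/klipschitz_monotoneP => s t [Is|->] [It|->] st; rewrite ?ltxx ?ltT //.
- by have /klipschitz_monotoneP := lipg; apply.
- exact: lg.
- by have := lt_le_trans (ltT t It) st; rewrite ltxx.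
- by rewrite subrr normr0 subrr mulr0.
Qed.

Lemma flow_on_add_end C f I g T M :
  is_interval (I `|` [set T]) -> I !=set0 -> (forall t, I t -> t < T) ->
  0 <= M -> M.-lipschitz_I g -> flow_on C f I g ->
  exists2 y, (forall t, I t -> y t = g t) & flow_on C f (I `|` [set T]) y.
Proof.
move=> itvIT I0 ltT M0 lipg [_ Cg dg].
have [l] := klipschitz_extend_end I0 ltT M0 lipg; set y := fun t => _ => lipy.
have yl t : t < T -> y t = g t by rewrite /y => ->.
have Il t : (I `|` [set T]) t -> t < T -> I t by move=> [//|->]; rewrite ltxx.
exists y => [t /ltT|]; first exact: yl.
split=> [|t It|]; first exact: klipschitz_loc_abs_cont lipy.
  have tT : t < T.
    by have [s ts [/ltT|/= <-//]] := interior_gt It; exact: lt_trans.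
  rewrite yl //; apply: Cg; rewrite /interior.
  by apply: filterS2 It (lt_nbhsl tT) => s; exact: Il.
apply: filterS2 dg (lebesgue_ae_neq T) => t dg tT [It|//].
rewrite yl ?ltT //; apply: near_eq_is_derive (dg It) => //.
by apply: filterS (lt_nbhsl (ltT t It)) => s sT; rewrite yl.
Qed.

End Flows.

Section Solutions.
Variables (R : realType) (N : nat).
Variables (C : set 'cV[R]_N) (f : 'cV[R]_N -> 'cV[R]_N).
Variables (D : set 'cV[R]_N) (G : 'cV[R]_N -> set 'cV[R]_N).
Implicit Types (a b s t T M : R) (j k J : nat) (y : R -> 'cV[R]_N).

Lemma is_solutionP (dom : set (R * nat)) (phi : R -> nat -> 'cV[R]_N) :
  is_solution C f D G dom phi <->
  [/\ hybrid_time_domain dom /\ dom (0, 0%N),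
      closure C (phi 0 0%N) \/ D (phi 0 0%N),
      forall j, flow_on C f (slice dom j) (phi ^~ j) &
      forall t j, dom (t, j) -> dom (t, j.+1) ->
        D (phi t j) /\ G (phi t j) (phi t j.+1)].
Proof.
split=> [[[hE d00 ac] S0 flow jump]|[[hE d00] S0 flow jump]].
  by split=> // j; have [Cj dj] := flow j; split.
by split=> // [|j]; [split=> // j|]; have [] := flow j.
Qed.

Variables (dom : set (R * nat)) (phi : R -> nat -> 'cV[R]_N).

Lemma solution_flow_on j a b : is_solution C f D G dom phi ->
  dom (a, j) -> dom (b, j) -> flow_on C f `[a, b] (phi ^~ j).
Proof.
move=> /is_solutionP[[hE _] _ flow _] da db; apply: flow_onS (flow j) => t.
by rewrite /= in_itv /=; exact: (slice_interval hE).
Qed.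

Lemma solution_in_closed t j : closed C -> D `<=` C ->
  (forall x g, D x -> G x g -> C g) ->
  is_solution C f D G dom phi -> dom (t, j) -> C (phi t j).
Proof.
move=> closedC DC GC sol; have /is_solutionP[[hE _] S0 _ jump] := sol.
move: t j; apply: (hybrid_time_ind (P := fun t j => C (phi t j)) hE).
- by case: S0 => [|/DC]; rewrite -?(closure_id C).1.
- move=> s t j ds dt; rewrite le_eqVlt => /orP[/eqP<-//|st] _.
  have flow_phi := solution_flow_on sol ds dt; have [_ Cphi _] := flow_phi.
  suff : closure C (phi t j) by rewrite -(closure_id C).1.
  move=> B /nbhs_ballP[e /= e0 eB].
  have stt : s <= t <= t by rewrite lexx ltW.
  have /nbhs_ballP[d /= d0 phi_d] : \forall r \near t,
      (s <= r <= t -> `|phi r j - phi t j| < e) /\ s < r.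
    apply: filterI; last exact: lt_nbhsr.
    exact: abs_cont_near (flow_on_abs_cont (ltW st) flow_phi) e0 stt.
  pose r := t - Num.min d (t - s) / 2.
  have r0 : 0 < Num.min d (t - s) by rewrite lt_min d0 subr_gt0.
  have rd : Num.min d (t - s) <= d by rewrite ge_min lexx.
  have rt : r < t by rewrite /r; lra.
  have [|phi_r sr] := phi_d r; first by rewrite /ball /= ger0_norm /r; lra.
  exists (phi r j); split.
    apply: Cphi; rewrite /interior.
    apply: filterS2 (lt_nbhsr sr) (lt_nbhsl rt) => u su ut.
    by rewrite /= in_itv /= !ltW.
  by apply: eB; rewrite -ball_normE /= distrC phi_r // !ltW.
- by move=> t j dt dt' _; have [Dt Gt] := jump t j dt dt'; exact: GC Gt.
Qed.

Hypothesis maxi : maximal_solution C f D G dom phi.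

Let sol : is_solution C f D G dom phi := maxi.1.

Lemma maximal_replace_level J (I : set R) y :
  hybrid_time_domain (dom `|` [set p | p.2 = J /\ I p.1]) ->
  flow_on C f (slice dom J `|` I) y -> (forall t, dom (t, J) -> y t = phi t J) ->
  (forall t j, J = j.+1 -> dom (t, j) -> I t -> ~ dom (t, J) ->
     D (phi t j) /\ G (phi t j) (y t)) ->
  (forall t, I t -> dom (t, J.+1) -> dom (t, J)) ->
  forall t, I t -> dom (t, J).
Proof.
set dom' := dom `|` _ => hE' flow_y yE jump_in jump_out t It.
have /is_solutionP[[_ d00] S0 flow jump] := sol.
pose phi' s j := if j == J then y s else phi s j.
have phi'E s j : dom (s, j) -> phi' s j = phi s j.
  by rewrite /phi'; case: eqP => [->|//]; exact: yE.
have sliceJ : slice dom' J = slice dom J `|` I.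
  by apply/seteqP; split=> s [Es|]; [left|case; right|left|right].
have sliceN j : j != J -> slice dom' j = slice dom j.
  by move=> /eqP jJ; apply/seteqP; split=> s; [case=> // -[]|left].
suff sol' : is_solution C f D G dom' phi'.
  by rewrite -(maxi.2 dom' phi' sol') //; [right|move=> p; left].
apply/is_solutionP; split.
- by split=> //; left.
- by rewrite phi'E.
- move=> j; have [->|jJ] := eqVneq j J; first by rewrite sliceJ /phi' eqxx.
  by rewrite sliceN // /phi' (negbTE jJ); exact: flow.
- move=> s j [ds|[/= jJ Is]] [ds'|[/= jJ' Is']].
  + by rewrite !phi'E //; exact: jump.
  + have [ds'|nds'] := pselect (dom (s, j.+1)); first by rewrite !phi'E //; exact: jump.
    by rewrite phi'E // /phi' jJ' eqxx; apply: jump_in; rewrite -?jJ'.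
  + have ds : dom (s, j) by rewrite jJ; apply: jump_out; rewrite -?jJ.
    by rewrite !phi'E //; exact: jump.
  + by move: jJ' => /eqP; rewrite jJ gtn_eqF.
Qed.

Lemma maximal_prolong J T1 T2 y : time_ordered dom -> top_level dom J ->
  dom (T1, J) -> T1 <= T2 -> flow_on C f (slice dom J `|` `[T1, T2]) y ->
  (forall t, dom (t, J) -> y t = phi t J) -> dom (T2, J).
Proof.
move=> ord top dT1 T12 flow_y yE; have /is_solutionP[[hE _] _ _ _] := sol.
have hE' := hybrid_time_domain_prolong (T2 := T2) hE ord top dT1.
apply: (@maximal_replace_level J [set t | T1 <= t <= T2] y hE') => //.
- move=> t j JE djt /andP[T1t _] [].
  have tT1 : t <= T1 by apply: ord djt dT1 _; rewrite JE.
  by rewrite (_ : t = T1) //; apply: le_anti; rewrite tT1.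
- by move=> t _ /top.2; rewrite ltnn.
- by rewrite /= lexx T12.
Qed.

Lemma maximal_top_jump_empty J T : top_level dom J -> dom (T, J) -> D (phi T J) ->
  G (phi T J) = set0.
Proof.
move=> top dT DT; rewrite -subset0 => g Gg; have /is_solutionP[[hE _] _ _ _] := sol.
suff : dom (T, J.+1) by move=> /top.2; rewrite ltnn.
have hE' := hybrid_time_domain_jump hE top dT.
apply: (@maximal_replace_level J.+1 [set t | T <= t <= T] (cst g) hE') => //=.
- have -> : slice dom J.+1 `|` [set t | T <= t <= T] = [set T].
    apply/seteqP; split=> t; first by case=> [/top.2|/le_anti->//]; rewrite ltnn.
    by move=> ->; right; rewrite /= lexx.
  exact: flow_on_set1.
- by move=> t /top.2; rewrite ltnn.
- by move=> t j [<-] _ /le_anti<- _.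
- by move=> t _ /top.2; rewrite ltnNge leqnSn.
- by rewrite lexx.
Qed.

End Solutions.

Section Completeness.
Variables (R : realType) (N : nat).
Variables (C : set 'cV[R]_N) (f : 'cV[R]_N -> 'cV[R]_N).
Variables (D : set 'cV[R]_N) (G : 'cV[R]_N -> set 'cV[R]_N).
Variables (dom : set (R * nat)) (phi : R -> nat -> 'cV[R]_N).
Hypothesis maxi : maximal_solution C f D G dom phi.
Hypothesis ord : time_ordered dom.
Variable M : R.
Hypothesis speed_le : forall t j, dom (t, j) -> `|f (phi t j)| <= M.

Lemma maximal_contains_sup J : top_level dom J -> has_ubound (slice dom J) ->
  dom (sup (slice dom J), J).
Proof.
move=> top ubJ; have [t0 dt0] := top.1; set T := sup _.
have /is_solutionP[[hE _] _ flow _] := maxi.1.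
have itvJ := @slice_interval _ _ J hE.
have supJ : has_sup (slice dom J) by split=> //; exists t0.
apply: contrapT => ndT.
have ltT t : dom (t, J) -> t < T.
  move=> dt; rewrite lt_neqAle ub_le_sup // andbT.
  by apply/eqP => tT; rewrite tT in dt.
have t0T t : t0 <= t < T -> slice dom J t.
  move=> /andP[t0t]; rewrite -subr_gt0 => /(sup_adherent)/(_ supJ)[s ds].
  by rewrite subKr => /ltW ts; apply: (itvJ t0 s) => //; rewrite t0t.
have UE : slice dom J `|` `[t0, T] = slice dom J `|` [set T].
  apply/seteqP; split=> t [Jt|]; try by left.
    rewrite /= in_itv /= => /andP[t0t]; rewrite le_eqVlt => /orP[/eqP->|tT].
      by right.
    by left; apply: t0T; rewrite t0t.
  by move=> ->; right; rewrite /= in_itv /= lexx ltW // ltT.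
have itvU : is_interval (slice dom J `|` [set T]).
  rewrite -UE; apply/connected_intervalP/connectedU.
  - by exists t0; split; rewrite //= in_itv /= lexx ltW // ltT.
  - exact/connected_intervalP.
  - exact: segment_connected.
have M0 : 0 <= M by apply: le_trans (speed_le dt0).
have lip_phi := flow_on_klipschitz itvJ (flow J) (fun t => @speed_le t J).
have [y yE flow_y] := flow_on_add_end itvU top.1 ltT M0 lip_phi (flow J).
apply: ndT; apply: (maximal_prolong maxi ord top dt0 (ltW (ltT t0 dt0)) _ yE).
by rewrite UE.
Qed.

Theorem bounded_speed_complete :
  (forall x, D x -> G x !=set0) -> (forall t j, dom (t, j) -> C (phi t j)) ->
  (forall t j, dom (t, j) -> ~ D (phi t j) -> exists h y,
     [/\ 0 < h, y t = phi t j & flow_on C f `[t, t + h] y]) ->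
  complete_dom dom.
Proof.
move=> G0 Cphi viable; have /is_solutionP[[hE d00] _ flow _] := maxi.1.
apply: contrapT => /existsNP[b /forallNP nb].
have le_b t j : dom (t, j) -> t + j%:R <= b.
  by move=> dt; rewrite leNgt; apply/negP => bt; apply: (nb t); exists j.
have [J top] := bounded_top_level hE d00 le_b.
have ubJ : has_ubound (slice dom J).
  by exists b => t /le_b; have : (0 : R) <= J%:R by []; lra.
have := maximal_contains_sup top ubJ; set T := sup _ => dT.
have leT t : dom (t, J) -> t <= T by move=> dt; exact: ub_le_sup.
have nDT : ~ D (phi T J).
  move=> DT; have [g] := G0 _ DT.
  by rewrite (maximal_top_jump_empty maxi top dT DT).
have [h [y [h0 yT flow_y]]] := viable T J dT nDT.
have T_Th : T <= T + h by rewrite lerDl ltW.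
have := flow_on_cat dT leT T_Th yT (Cphi T J dT) (flow J) flow_y.
move=> /(maximal_prolong maxi ord top dT T_Th) contains.
have /leT : dom (T + h, J).
  apply: contains => t dt; have := leT t dt.
  by rewrite le_eqVlt => /orP[/eqP->|->//]; rewrite ltxx.
by rewrite gerDl leNgt h0.
Qed.

End Completeness.

(** * Lyapunov functions *)

Section Lyapunov.
Variables (R : realType) (N : nat).
Variables (C : set 'cV[R]_N) (f : 'cV[R]_N -> 'cV[R]_N).
Variables (V : 'cV[R]_N -> R) (r c : R).
Hypotheses (VC1 : C1 V) (f_continuous : continuous f) (r0 : 0 < r).
Hypothesis V_ge0 : forall x, C x -> 0 <= V x.
Hypothesis V_flow : forall x, C x -> V x <= c -> 'd V x (f x) <= - r * V x.
Hypothesis V_flow_near_zero : forall x, C x -> V x = 0 ->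
  \forall w \near x, C w -> 'd V w (f w) <= 0.

Let V_continuous : continuous V.
Proof. by move=> x; apply: differentiable_continuous; exact: VC1.1. Qed.

(* Where [V x = c > 0] the derivative is negative, hence so it is nearby,
   outside the sublevel set too. *)
Lemma derive_along_le0_near x : C x -> V x <= c ->
  \forall w \near x, C w -> 'd V w (f w) <= 0.
Proof.
move=> Cx Vxc; have [Vx0|Vx0] := eqVneq (V x) 0; first exact: V_flow_near_zero.
have [Vx|cV] := ltP (V x) c.
  have V_near : \forall w \near x, V w < c := V_continuous (lt_nbhsl Vx).
  apply: filterS V_near => w /ltW Vw Cw.
  apply: le_trans (V_flow Cw Vw) _.
  by rewrite mulNr oppr_le0 mulr_ge0 ?V_ge0 // ltW.
have dVneg : 'd V x (f x) < 0.
  apply: le_lt_trans (V_flow Cx Vxc) _.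
  by rewrite mulNr oppr_lt0 mulr_gt0 // lt_neqAle eq_sym Vx0 V_ge0.
have dV_near : \forall w \near x, 'd V w (f w) < 0 :=
  C1_diff_continuous VC1 f_continuous (lt_nbhsl dVneg).
by apply: filterS dV_near => w /ltW.
Qed.

Section Flow.
Variables (g : R -> 'cV[R]_N) (a b : R).
Hypotheses (flow_g : flow_on C f `[a, b] g) (Cg : forall t, a <= t <= b -> C (g t)).

Let flow_g_abs_cont s t : a <= s -> s <= t -> t <= b -> abs_cont g s t.
Proof.
move=> as_ st tb; apply: (abs_cont_sub as_ tb).
by apply: flow_on_abs_cont flow_g; exact: le_trans (le_trans st tb).
Qed.

Lemma derive_along_flow_ae : \forall t \ae (@lebesgue_measure R), a <= t <= b ->
  is_derive t 1 (V \o g) ('d V (g t) (f (g t))).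
Proof.
have [_ _ dg] := flow_g; apply: filterS dg => t dg tab.
by apply: is_derive_comp_diff; [exact: VC1.1|exact: dg].
Qed.

Lemma sublevel_flow_invariant t : a <= t <= b -> V (g a) <= c -> V (g t) <= c.
Proof.
move=> /andP[at_ tb] Vac; pattern t; apply: (real_induction at_) => // x axt.
have /andP[ax xt] := axt; have xab : a <= x <= b by rewrite ax (le_trans xt).
have near_x e : 0 < e -> \forall s \near x, a <= s <= t -> `|g s - g x| < e.
  by move=> e0; exact: abs_cont_near (flow_g_abs_cont (lexx a) at_ tb) e0 axt.
have [Vx|cVx] := leP (V (g x)) c; last first.
  have V_near : \forall w \near g x, c < V w := V_continuous (lt_nbhsr cVx).
  have /nbhs_ballP[e /= e0 eV] := V_near.
  apply: (straddling_near (near_x e e0)) => y z /andP[ay yx] /andP[xz zt] ge Vy.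
  have yt : y <= t := le_trans yx xt.
  move: Vy; rewrite leNgt => /negP[]; apply: eV; rewrite -ball_normE /= distrC.
  by apply: ge; rewrite ?lexx ?ay ?yt // (le_trans yx xz).
have /nbhs_ballP[e /= e0 ed] := derive_along_le0_near (Cg xab) Vx.
apply: (straddling_near (near_x e e0)) => y z /andP[ay yx] /andP[xz zt] ge.
have yz := le_trans yx xz; have zb := le_trans zt tb; apply: le_trans.
apply: (abs_cont_nonincreasing (W := V \o g) yz).
  by apply: abs_cont_C1_comp => //; exact: flow_g_abs_cont.
apply: filterS derive_along_flow_ae => s ds /andP[ys sz].
have [as_ sb] : a <= s /\ s <= b by rewrite (le_trans ay) // (le_trans sz).
exists ('d V (g s) (f (g s))); first by apply: ds; rewrite as_.
apply: ed; last by apply: Cg; rewrite as_.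
by rewrite -ball_normE /= distrC ge ?ys // as_ (le_trans sz).
Qed.

Lemma lyapunov_flow : a <= b -> V (g a) <= c ->
  V (g b) <= expR (- r * (b - a)) * V (g a).
Proof.
move=> ab Vac; apply: (abs_cont_gronwall (W := V \o g) ab).
  by apply: abs_cont_C1_comp => //; exact: flow_g_abs_cont.
apply: filterS derive_along_flow_ae => t dt tab.
exists ('d V (g t) (f (g t))); first exact: dt.
by apply: V_flow; [exact: Cg|exact: sublevel_flow_invariant].
Qed.

End Flow.

Lemma lyapunov_decay (D : set 'cV[R]_N) G dom phi t j :
  is_solution C f D G dom phi -> (forall t j, dom (t, j) -> C (phi t j)) ->
  (forall x g, D x -> G x g -> V g <= V x) ->
  V (phi 0 0%N) <= c -> dom (t, j) ->
  V (phi t j) <= expR (- r * t) * V (phi 0 0%N).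
Proof.
move=> sol Cphi V_jump V0c; have /is_solutionP[[hE d00] _ _ jump] := sol.
have V00 := V_ge0 (Cphi _ _ d00).
pose decay t j := V (phi t j) <= expR (- r * t) * V (phi 0 0%N).
apply: (hybrid_time_ind (P := decay) hE) => [|s T k ds dT sT Vs|T k dT dT' VT].
- by rewrite /decay mulr0 expR0 mul1r.
- have s0 := hybrid_time_ge0 hE ds.
  have Vsc : V (phi s k) <= c.
    apply: le_trans Vs (le_trans _ V0c); rewrite -[leRHS]mul1r ler_wpM2r //.
    by rewrite expR_le1 mulNr oppr_le0 mulr_ge0 // ltW.
  have CsT u : s <= u <= T -> C (phi u k).
    by move=> suT; apply/Cphi/(slice_interval hE ds dT).
  have := lyapunov_flow (solution_flow_on sol ds dT) CsT sT Vsc.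
  move/le_trans; apply; apply: le_trans (ler_wpM2l (expR_ge0 _) Vs) _.
  by rewrite mulrA -expRD -mulrDr subrK.
- by have [DT GT] := jump T k dT dT'; apply: le_trans VT; exact: V_jump GT.
Qed.

End Lyapunov.

Section DecayEstimates.
Variable R : realType.
Implicit Types (a b k t d r : R).

Lemma ler_powR_inv k a b : 0 < k -> 0 <= a -> 0 <= b -> a `^ k <= b `^ k -> a <= b.
Proof.
move=> k0 a0 b0; apply: contraTT; rewrite -!ltNge => ba.
by apply: gt0_ltr_powR; rewrite ?nnegrE.
Qed.

Lemma powRVK k a : 0 < k -> 0 <= a -> (a `^ k^-1) `^ k = a.
Proof. by move=> k0 a0; rewrite -powRrM mulVf ?gt_eqF // powRr1. Qed.

Lemma powR_sandwich_decay k (c1 c2 s d d0 v v0 : R) :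
  0 < k -> 0 < c1 -> 0 < c2 -> 0 <= d -> 0 <= d0 ->
  c1 * d `^ k <= v -> v <= expR s * v0 -> v0 <= c2 * d0 `^ k ->
  d <= (c2 / c1) `^ k^-1 * expR (s / k) * d0.
Proof.
move=> k0 c10 c20 d_ge0 d0_ge0 dv vv0 v0d0.
apply: (ler_powR_inv k0) => //; first by rewrite !mulr_ge0 ?powR_ge0 ?expR_ge0.
rewrite powRM ?mulr_ge0 ?powR_ge0 ?expR_ge0 // powRM ?powR_ge0 ?expR_ge0 //.
rewrite powRVK //; last by rewrite divr_ge0 // ltW.
rewrite -expRM divfK ?gt_eqF // -(ler_pM2l c10).
apply: le_trans dv (le_trans vv0 (le_trans (ler_wpM2l (expR_ge0 _) v0d0) _)).
by rewrite le_eqVlt; apply/orP; left; apply/eqP; field; rewrite gt_eqF.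
Qed.

Lemma expR_hybrid_time a b r t (j : nat) : 0 <= b -> 0 <= r ->
  j%:R <= a + b * t ->
  expR (- r * t) <= expR (r / (1 + b) * a) * expR (- (r / (1 + b)) * (t + j%:R)).
Proof.
move=> b0 r0 jab; rewrite -expRD ler_expR.
have b1 : 0 < 1 + b by lra.
have : r / (1 + b) * j%:R <= r / (1 + b) * (a + b * t).
  by rewrite ler_wpM2l // divr_ge0 // ltW.
have -> : r / (1 + b) * (a + b * t) =
    r / (1 + b) * a + r * t - r / (1 + b) * t by field; rewrite gt_eqF.
by rewrite mulrDr; lra.
Qed.

Lemma expR_decay_vanishes (kappa lambda d e : R) :
  0 <= kappa -> 0 <= d -> 0 < lambda -> 0 < e ->
  exists M, forall s, M <= s -> kappa * expR (- lambda * s) * d <= e.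
Proof.
move=> kappa0 d0 lam0 e0; exists (kappa * d / e / lambda) => s.
rewrite !ler_pdivrMr // => Ms; rewrite mulrAC mulNr expRN ler_pdivrMr ?expR_gt0 //.
apply: le_trans Ms _; rewrite mulrC ler_wpM2l ?(ltW e0) // mulrC.
by have := expR_ge1Dx (lambda * s); lra.
Qed.

End DecayEstimates.

(** * The closed-loop system *)

Section MatrixNorms.
Variables (R : realType) (p r : nat).

Definition entry_norm_sum (M : 'M[R]_(p, r)) : R := \sum_i \sum_j `|M i j|.

Lemma entry_norm_sum_ge0 M : 0 <= entry_norm_sum M.
Proof. by apply: sumr_ge0 => i _; apply: sumr_ge0. Qed.

Lemma mulmx_klipschitz (M : 'M[R]_(p, r)) :
  (entry_norm_sum M).-lipschitz (mulmx M : 'cV[R]_r -> 'cV[R]_p).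
Proof.
apply/klipschitzP => x y _ _; rewrite -mulmxBr; move: (x - y) => {x y} x.
apply: norm_le_coord => [|i]; first by rewrite mulr_ge0 // entry_norm_sum_ge0.
rewrite mxE; apply: le_trans (ler_norm_sum _ _ _) _.
apply: (@le_trans _ _ ((\sum_j `|M i j|) * `|x|)).
  rewrite mulr_suml; apply: ler_sum => j _.
  by rewrite normrM ler_wpM2l // coord_le_norm.
rewrite ler_wpM2r // /entry_norm_sum (bigD1 i) //= lerDl.
by apply: sumr_ge0 => l _; apply: sumr_ge0.
Qed.

Lemma usubmx_norm_le (x : 'cV[R]_(p + r)) : `|usubmx x| <= `|x|.
Proof. by apply: norm_le_coord => // i; rewrite mxE coord_le_norm. Qed.

Lemma col_mx_norm_le (x : 'cV[R]_p) (y : 'cV[R]_r) M :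
  `|x| <= M -> `|y| <= M -> `|col_mx x y| <= M.
Proof.
move=> xM yM; apply: norm_le_coord => [|i]; first exact: le_trans xM.
by rewrite mxE; case: (fintype.split i) => j; apply: le_trans (coord_le_norm _ _) _.
Qed.

End MatrixNorms.

Lemma sat_clampE (R : realType) (u s : R) : 0 < u ->
  Order.min `|s| u * Num.sg s = Num.max (- u) (Num.min s u).
Proof.
move=> u0; have [s0|s0|->] := ltgtP s 0; last first.
- by rewrite sgr0 mulr0 min_l ?ltW // max_r // oppr_le0 ltW.
- rewrite gtr0_norm // gtr0_sg // mulr1 max_r // le_min.
  by apply/andP; split; lra.
- rewrite ltr0_norm // ltr0_sg // mulrN1 (min_l (x:=s)) ?(ltW (lt_trans s0 u0)) //.
  have [su|us] := leP (- s) u.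
    by rewrite opprK max_r // lerNl.
  by rewrite max_l // ltW // ltrNr.
Qed.

Lemma dz_vec_klipschitz (R : realType) (m : nat) (ub : 'cV[R]_m) :
  (forall i, 0 < ub i 0) -> 2.-lipschitz (dz_vec ub).
Proof.
move=> ub0; apply/klipschitzP => v w _ _.
apply: norm_le_coord => [|i]; first by rewrite mulr_ge0.
have vwi : `|v i 0 - w i 0| <= `|v - w|.
  by have := coord_le_norm (v - w) i; rewrite !mxE.
rewrite !mxE !sat_clampE // opprD addrACA -opprD.
apply: le_trans (ler_normB _ _) _; rewrite mulr_natl mulr2n; apply: lerD => //.
have /klipschitzP/(_ (v i 0) (w i 0) I I) := clamp_klipschitz (- ub i 0) (ub i 0).
by rewrite mul1r => /le_trans; apply.
Qed.

Section ClosedLoop.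
Variables (R : realType) (n m q : nat).
Variables (A : 'M[R]_n) (B : 'M[R]_(n, m)) (K : 'M[R]_(m, n)) (ub : 'cV[R]_m).
Local Notation fx := (fcl A B K ub : 'cV[R]_(n + n + q) -> 'cV[R]_(n + n + q)).

Lemma fcl_klipschitz : (forall i, 0 < ub i 0) ->
  exists2 L : R, 0 <= L & L.-lipschitz fx.
Proof.
move=> ub0; have S0 := @entry_norm_sum_ge0 R.
have lip_xbar : 1.-lipschitz (@xbar R n q).
  apply/klipschitzP => x y _ _; rewrite mul1r /xbar -linearB; exact: usubmx_norm_le.
have lip_linear :=
  klipschitz_comp (S0 _ _ (Acl A B K)) (mulmx_klipschitz (Acl A B K)) lip_xbar.
have lip_gain := klipschitz_comp (S0 _ _ (Kcl K)) (mulmx_klipschitz (Kcl K)) lip_xbar.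
have lip_dz := klipschitz_comp (ler0n R 2) (dz_vec_klipschitz ub0) lip_gain.
have lip_feedback := klipschitz_comp (S0 _ _ (Bcl B)) (mulmx_klipschitz (Bcl B)) lip_dz.
have /klipschitzP lip_plant := klipschitzD lip_linear lip_feedback.
set L := _ + _ in lip_plant; have L0 : 0 <= L by rewrite addr_ge0 // !mulr_ge0.
exists L => //; apply/klipschitzP => x y _ _.
rewrite /fcl opp_col_mx add_col_mx subrr; apply: col_mx_norm_le; first exact: lip_plant.
by rewrite normr0 mulr_ge0.
Qed.

Lemma tauE (x : 'cV[R]_(n + n + q)) i : tau x i 0 = x (rshift (n + n) i) 0.
Proof. by rewrite /tau mxE. Qed.

Lemma tau_flow C g a b i : a <= b -> flow_on C fx `[a, b] g ->
  tau (g b) i 0 = tau (g a) i 0 - (b - a).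
Proof.
move=> ab flow_g; have [_ _ dg] := flow_g; rewrite !tauE; set i' := rshift _ i.
suff : g b i' 0 - g a i' 0 = -1 * (b - a) by lra.
have acgi := abs_cont_coord i' (flow_on_abs_cont ab flow_g).
apply: (abs_cont_increment_eq ab acgi); apply: filterS dg => t dg tab.
have -> : -1 = fx (g t) i' 0 by rewrite -tauE /tau /fcl col_mxKd mxE.
by have /is_derive_colP := dg tab.
Qed.

Variables (ns : 'I_q -> nat) (T1 T2 : 'I_q -> R).
Hypotheses (T10 : forall i, 0 < T1 i) (T12 : forall i, T1 i <= T2 i).
Local Notation Cx := (@Ccl R n q T2).
Local Notation Dx := (@Dcl R n q T2).
Local Notation Gx := (Gcl ns T1 T2).

Lemma Ccl_closed : closed Cx.
Proof.
have -> : Cx = \bigcap_(i in [set: 'I_q])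
    ((fun x : 'cV[R]_(n + n + q) => x (rshift (n + n) i) 0 : R) @^-1` `[0, T2 i]).
  apply/seteqP; split=> x Cx_x i.
    by move=> _; rewrite /= in_itv /= -tauE; apply/andP.
  by have := Cx_x i I; rewrite /= in_itv /= -tauE => /andP.
apply: closed_bigI => i _; apply: preimage_closed; last exact: interval_closed.
by move=> x _; exact: coord_continuous.
Qed.

Lemma Dcl_sub_Ccl : Dx `<=` Cx.
Proof. by move=> x [i []]. Qed.

Lemma Gcl_sub_Ccl x g : Dx x -> Gx x g -> Cx g.
Proof.
move=> _ [i [[xT _] _ _ [g1 g2] gk]] j; have [->|ji] := eqVneq j i; last by rewrite gk.
by split=> //; apply: le_trans g1; exact: ltW.
Qed.

Lemma Gcl_nonempty x : Dx x -> Gx x !=set0.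
Proof.
move=> [i [xT xi]].
pose v : 'cV[R]_q := \col_k (if k == i then T2 i else tau x k 0).
exists (col_mx (col_mx (xp x) (hblk ns i (Defs.eta x))) v), i; split=> //.
- by rewrite /xp /xbar !col_mxKu.
- by rewrite /Defs.eta /xbar col_mxKu col_mxKd.
- by rewrite /tau col_mxKd mxE eqxx; split.
- by move=> j /negbTE ji; rewrite {1}/tau col_mxKd mxE ji.
Qed.

Section Solution.
Variables (dom : set (R * nat)) (phi : R -> nat -> 'cV[R]_(n + n + q)).
Hypothesis sol : is_solution Cx fx Dx Gx dom phi.

Lemma solution_in_Ccl t j : dom (t, j) -> Cx (phi t j).
Proof. exact: (solution_in_closed Ccl_closed Dcl_sub_Ccl Gcl_sub_Ccl sol). Qed.

(* A hybrid time domain may by itself both flow and jump from one hybrid time;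
   here a jump requires a vanishing timer, which cannot decrease further. *)
Lemma solution_time_ordered : time_ordered dom.
Proof.
move=> s k T J ds dT kJ; have /is_solutionP[[hE _] _ _ jump] := sol.
have [r [dr dr' rT]] := jump_time hE dT kJ; apply: le_trans rT.
rewrite leNgt; apply/negP => rs; have [[i [_ ti]] _] := jump r k dr dr'.
have := tau_flow i (ltW rs) (solution_flow_on sol dr ds); rewrite ti.
by have [tau_ge0 _] := solution_in_Ccl ds i; lra.
Qed.

Lemma jump_count_le t j : dom (t, j) ->
  j%:R <= \sum_i T2 i / T1 i + (\sum_i (T1 i)^-1) * t.
Proof.
move=> dtj; have /is_solutionP[[hE d00] _ _ jump] := sol.
pose S (x : 'cV[R]_(n + n + q)) := \sum_i tau x i 0 / T1 i.
have T1V i : 0 <= (T1 i)^-1 by rewrite invr_ge0 ltW.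
pose count_le t j := j%:R <= S (phi t j) + (\sum_i (T1 i)^-1) * t.
suff count : count_le t j.
  apply: le_trans count _; rewrite lerD2r; apply: ler_sum => i _.
  by rewrite ler_wpM2r //; have [] := solution_in_Ccl dtj i.
apply: (hybrid_time_ind (P := count_le) hE) dtj
  => [|s T k ds dT sT count|T k dT dT' count].
- rewrite /count_le mulr0 addr0; apply: sumr_ge0 => i _.
  by apply: mulr_ge0; [have [] := solution_in_Ccl d00 i|].
- apply: le_trans count _.
  have -> : S (phi s k) = S (phi T k) + (\sum_i (T1 i)^-1) * (T - s).
    rewrite /S mulr_suml -big_split /=; apply: eq_bigr => i _.
    by rewrite (tau_flow i sT (solution_flow_on sol ds dT)); ring.
  by rewrite -addrA -mulrDr subrK.
- have [_ [i [[_ xi] _ _ [g1 _] gk]]] := jump T k dT dT'.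
  have S_jump : 1 + S (phi T k) <= S (phi T k.+1).
    rewrite /S (bigD1 i) //= [leRHS](bigD1 i) //= xi mul0r add0r.
    have -> : \sum_(l < q | l != i) tau (phi T k.+1) l 0 / T1 l =
        \sum_(l < q | l != i) tau (phi T k) l 0 / T1 l.
      by apply: eq_bigr => l /gk ->.
    by rewrite lerD2r ler_pdivlMr // mul1r.
  by move: count; rewrite /count_le -natr1; lra.
Qed.

End Solution.

Lemma exists_pos_lower_bound (I : finType) (e : R) (F : I -> R) :
  0 < e -> (forall i, 0 < F i) -> exists h, [/\ 0 < h, h <= e & forall i, h <= F i].
Proof.
move=> e0 F0; exists (\big[Num.min/e]_i F i); split.
- by apply: lt_bigmin => // i _; exact: F0.
- exact: bigmin_le_id.
- by move=> i; exact: bigmin_le_cond.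
Qed.

Lemma exists_flow_from (x : 'cV[R]_(n + n + q)) (T : R) :
  (forall i, 0 < ub i 0) -> Cx x -> ~ Dx x ->
  exists h y, [/\ 0 < h, y T = x & flow_on Cx fx `[T, T + h] y].
Proof.
move=> ub0 Cx_x nDx; have [L L0 lipf] := fcl_klipschitz ub0.
have tau_gt0 i : 0 < tau x i 0.
  rewrite lt_neqAle; have [-> _] := Cx_x i; rewrite andbT; apply/eqP => xi.
  by apply: nDx; exists i.
have L1 : 0 < L + 1 by rewrite ltr_wpDl.
have L1V : 0 < (L + 1)^-1 by rewrite invr_gt0.
have [h [h0 hL h_tau]] := exists_pos_lower_bound L1V tau_gt0.
have hL' : h * L < 1.
  by have := ler_wpM2r (ltW L1) hL; rewrite mulVf ?gt_eqF //; nra.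
have [y yT flow_y] := klipschitz_flow_exists T x lipf L0 (ltW h0) hL'.
exists h, y; split=> //; have [acy _ dy] := flow_y; split=> // t /interior_subset.
rewrite /= in_itv /= => /andP[Tt tTh] i.
have flow_yt : flow_on setT fx `[T, t] y.
  by apply: flow_onS flow_y => s; rewrite /= !in_itv /= => /andP[-> /le_trans->].
rewrite (tau_flow i Tt flow_yt) yT.
by have := h_tau i; have [] := Cx_x i; split; lra.
Qed.

Lemma closed_loop_complete dom phi (M : R) :
  (forall i, 0 < ub i 0) -> maximal_solution Cx fx Dx Gx dom phi ->
  (forall t j, dom (t, j) -> `|fx (phi t j)| <= M) -> complete_dom dom.
Proof.
move=> ub0 maxi speed_le; have sol := maxi.1.
apply: (bounded_speed_complete maxi (solution_time_ordered sol) speed_le).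
- exact: Gcl_nonempty.
- exact: (solution_in_Ccl sol).
- by move=> t j dt nD; apply: exists_flow_from => //; exact: (solution_in_Ccl sol).
Qed.

End ClosedLoop.

(** * Exponential stability *)

Section Attractor.
Variables (R : realType) (n q : nat) (T2 : 'I_q -> R).
Hypothesis T20 : forall i, 0 <= T2 i.
Implicit Type x : 'cV[R]_(n + n + q).

Lemma coord_le_eucl N (v : 'cV[R]_N) i : `|v i 0| <= eucl v.
Proof.
rewrite -sqrtr_sqr /eucl ler_wsqrtr // (bigD1 i) //= lerDl.
by apply: sumr_ge0 => j _; exact: sqr_ge0.
Qed.

Lemma xbar_le_distA x : `|xbar x| <= distA T2 x.
Proof.
pose a0 : 'cV[R]_(n + n + q) := col_mx (0 : 'cV[R]_(n + n)) 0.
apply: lb_le_inf.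
  exists (eucl (x - a0)), a0 => //; split; first by rewrite /xbar col_mxKu.
  by move=> i; rewrite /tau col_mxKd mxE lexx.
move=> _ [a [a_0 _] <-]; apply: norm_le_coord => [|i]; first exact: sqrtr_ge0.
have -> : xbar x i 0 = (x - a) (lshift q i) 0.
  have : xbar a i 0 = 0 by rewrite a_0 mxE.
  by rewrite /xbar !mxE => ->; rewrite subr0.
exact: coord_le_eucl.
Qed.

Lemma distA_ge0 x : 0 <= distA T2 x.
Proof. exact: le_trans (xbar_le_distA x). Qed.

Lemma Ccl_norm_le x : @Ccl R n q T2 x -> `|x| <= distA T2 x + \sum_i T2 i.
Proof.
move=> Cx; rewrite -[in leLHS](vsubmxK x).
have T2_sum_ge0 : 0 <= \sum_i T2 i by apply: sumr_ge0.
apply: col_mx_norm_le; first by apply: le_trans (xbar_le_distA x) _; rewrite lerDl.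
apply: norm_le_coord => [|i]; first by rewrite addr_ge0 ?distA_ge0.
have [x0 x2] := Cx i; rewrite ger0_norm //; apply: le_trans x2 _.
rewrite (bigD1 i) //= addrCA lerDl addr_ge0 ?distA_ge0 //.
by apply: sumr_ge0.
Qed.

End Attractor.

Section ExponentialDecay.
Variables (R : realType) (N : nat).
Variables (C : set 'cV[R]_N) (f : 'cV[R]_N -> 'cV[R]_N).
Variables (D : set 'cV[R]_N) (G : 'cV[R]_N -> set 'cV[R]_N).
Variables (dist : 'cV[R]_N -> R) (kappa lambda : R).
Hypotheses (kappa0 : 0 < kappa) (lambda0 : 0 < lambda).

Definition exp_decay (dom : set (R * nat)) (phi : R -> nat -> 'cV[R]_N) : Prop :=
  complete_dom dom /\ forall t j, dom (t, j) ->
    dist (phi t j) <= kappa * expR (- lambda * (t + j%:R)) * dist (phi 0 0%N).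

Lemma exp_decay_basin x : 0 <= dist x ->
  (forall dom phi, maximal_solution C f D G dom phi -> phi 0 0%N = x ->
     exp_decay dom phi) ->
  basin C f D G dist x.
Proof.
move=> dist0 decay dom phi maxi phi0; have [cmpl est] := decay dom phi maxi phi0.
split=> // e e0; rewrite phi0 in est.
have [M small] := expR_decay_vanishes (ltW kappa0) dist0 lambda0 e0.
by exists M => t j dt /small; apply: le_trans; exact: est.
Qed.

End ExponentialDecay.

Section ClosedLoopStability.
Variables (R : realType) (n m q : nat) (ns : 'I_q -> nat).
Variables (A : 'M[R]_n) (B : 'M[R]_(n, m)) (K : 'M[R]_(m, n)) (ub : 'cV[R]_m).
Variables (T1 T2 : 'I_q -> R).
Hypotheses (ub0 : forall i, 0 < ub i 0) (T10 : forall i, 0 < T1 i).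
Hypothesis (T12 : forall i, T1 i <= T2 i).
Variables (V : 'cV[R]_(n + n + q) -> R) (k c1 c2 c3 : R) (U : set 'cV[R]_(n + n)).
Hypotheses (VC1 : C1 V) (k0 : 0 < k) (c10 : 0 < c1) (c20 : 0 < c2) (c30 : 0 < c3).
Hypothesis (nbhsU : nbhs (0 : 'cV[R]_(n + n)) U).

Local Notation Cx := (@Ccl R n q T2).
Local Notation Dx := (@Dcl R n q T2).
Local Notation Gx := (Gcl ns T1 T2).
Local Notation fx := (fcl A B K ub : 'cV[R]_(n + n + q) -> 'cV[R]_(n + n + q)).
Local Notation dist := (@distA R n q T2).
Local Notation sublevel c := [set x | Cx x /\ V x <= c].
Local Notation UT := [set x | U (xbar x) /\ Tset T2 (tau x)].

Hypothesis V_bounds : forall x, Cx x ->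
  c1 * dist x `^ k <= V x /\ V x <= c2 * dist x `^ k.
Hypothesis V_flow : forall x, U (xbar x) -> Tset T2 (tau x) ->
  'd V x (fx x) <= - c3 * V x.
Hypothesis V_jump : forall x g, Dx x -> Gx x g -> V g - V x <= 0.

Let T20 i : 0 <= T2 i. Proof. exact: le_trans (ltW (T10 i)) (T12 i). Qed.

Let V_ge0 x : Cx x -> 0 <= V x.
Proof.
by move=> /V_bounds[V_ge _]; apply: le_trans V_ge; rewrite mulr_ge0 ?powR_ge0 // ltW.
Qed.

Lemma flow_nonincreasing_near_attractor x : Cx x -> V x = 0 ->
  \forall w \near x, Cx w -> 'd V w (fx w) <= 0.
Proof.
move=> Cx_x Vx0.
have x0 : xbar x = 0.
  apply/eqP; rewrite -normr_le0; apply: le_trans (xbar_le_distA T20 x) _.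
  have [+ _] := V_bounds Cx_x; rewrite Vx0 pmulr_rle0 // => dist_le0.
  have : dist x `^ k == 0 by rewrite eq_le dist_le0 powR_ge0.
  by rewrite powR_eq0 => /andP[/eqP -> _].
have /nbhs_ballP[r /= r0 rU] := nbhsU.
apply/nbhs_ballP; exists r => //= w xw Cw.
have Uw : U (xbar w).
  apply: rU; rewrite -ball_normE /= -x0; rewrite -ball_normE /= in xw.
  by apply: le_lt_trans xw; rewrite /xbar -linearB; exact: usubmx_norm_le.
apply: le_trans (V_flow Uw Cw) _.
by rewrite mulNr oppr_le0 mulr_ge0 ?(ltW c30) // V_ge0.
Qed.

Section Sublevel.
Variable c : R.
Hypothesis sub : sublevel c `<=` UT.
Variables (dom : set (R * nat)) (phi : R -> nat -> 'cV[R]_(n + n + q)).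
Hypotheses (maxi : maximal_solution Cx fx Dx Gx dom phi) (V0c : V (phi 0 0%N) <= c).

Let phi_Ccl t j : dom (t, j) -> Cx (phi t j).
Proof. exact: (solution_in_Ccl T10 maxi.1). Qed.

Let rate := c3 / k.
Let gain := (c2 / c1) `^ k^-1.

Let d00 : dom (0, 0%N).
Proof. by have /is_solutionP[[]] := maxi.1. Qed.

Lemma distA_decay t j : dom (t, j) ->
  dist (phi t j) <= gain * expR (- rate * t) * dist (phi 0 0%N).
Proof.
move=> dt; have -> : - rate * t = - c3 * t / k by rewrite /rate; ring.
apply: (powR_sandwich_decay (v := V (phi t j)) (v0 := V (phi 0 0%N)) k0 c10 c20).
- exact: distA_ge0.
- exact: distA_ge0.
- by have [] := V_bounds (phi_Ccl dt).
- have [L L0 lipf] := fcl_klipschitz q A B K ub0.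
  apply: (lyapunov_decay VC1 (klipschitz_continuous lipf) c30 V_ge0 _
    flow_nonincreasing_near_attractor maxi.1 phi_Ccl _ V0c dt)
    => [x Cx_x Vx|x g Dx_x Gg].
    by have [Ux Tx] := sub (conj Cx_x Vx); exact: V_flow.
  by rewrite -subr_le0; exact: V_jump Gg.
- by have [] := V_bounds (phi_Ccl d00).
Qed.

Lemma sublevel_complete : complete_dom dom.
Proof.
have [L L0 /klipschitzP lipf] := fcl_klipschitz q A B K ub0.
have gain0 : 0 <= gain by exact: powR_ge0.
have dist_le t j : dom (t, j) -> dist (phi t j) <= gain * dist (phi 0 0%N).
  move=> dt; apply: le_trans (distA_decay dt) _.
  rewrite mulrAC -[leRHS]mulr1 ler_wpM2l ?mulr_ge0 ?distA_ge0 //.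
  have /is_solutionP[[hE _] _ _ _] := maxi.1.
  rewrite expR_le1 mulNr oppr_le0 mulr_ge0 //; first by rewrite divr_ge0 // ltW.
  exact: hybrid_time_ge0 hE dt.
apply: (closed_loop_complete T10 T12
  (M := L * (gain * dist (phi 0 0%N) + \sum_i T2 i) + `|fx 0|) ub0 maxi) => t j dt.
rewrite -[X in `|X|](subrK (fx 0)); apply: le_trans (ler_normD _ _) _; rewrite lerD2r.
apply: le_trans (lipf _ _ I I) _; rewrite ler_wpM2l // subr0.
by apply: le_trans (Ccl_norm_le T20 (phi_Ccl dt)) _; rewrite lerD2r dist_le.
Qed.

End Sublevel.

Lemma sublevel_exp_decay : exists kappa lambda : R, [/\ 0 < kappa, 0 < lambda &
  forall c, sublevel c `<=` UT -> forall dom phi,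
    maximal_solution Cx fx Dx Gx dom phi -> V (phi 0 0%N) <= c ->
    exp_decay dist kappa lambda dom phi].
Proof.
pose a := \sum_i T2 i / T1 i; pose b := \sum_i (T1 i)^-1.
have b0 : 0 <= b by apply: sumr_ge0 => i _; rewrite invr_ge0 ltW.
pose lambda := c3 / k / (1 + b).
exists ((c2 / c1) `^ k^-1 * expR (lambda * a)), lambda; split.
- by rewrite mulr_gt0 ?expR_gt0 // powR_gt0 // divr_gt0.
- by rewrite !divr_gt0 // ltr_pwDl.
move=> c sub dom phi maxi V0c; split=> [|t j dt]; first exact: sublevel_complete V0c.
apply: le_trans (distA_decay sub maxi V0c dt) _.
rewrite ler_wpM2r ?distA_ge0 // -mulrA ler_wpM2l ?powR_ge0 //.
apply: expR_hybrid_time => //; first by rewrite divr_ge0 // ltW.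
exact: (jump_count_le T10 maxi.1).
Qed.

Lemma exists_sublevel_sub : exists2 c, 0 < c & sublevel c `<=` UT.
Proof.
have /nbhs_ballP[r /= r0 rU] := nbhsU.
have r20 : 0 < r / 2 by rewrite divr_gt0.
exists (c1 * (r / 2) `^ k) => [|x [Cx_x Vx]]; first by rewrite mulr_gt0 // powR_gt0.
split=> //; apply: rU; rewrite -ball_normE /= sub0r normrN.
apply: le_lt_trans (xbar_le_distA T20 x) (le_lt_trans (_ : _ <= r / 2) _); last by lra.
apply: (ler_powR_inv k0); [exact: distA_ge0|exact: ltW|].
by rewrite -(ler_pM2l c10); have [+ _] := V_bounds Cx_x; move/le_trans; apply.
Qed.

Lemma V_le_of_distA_le c x : 0 < c -> Cx x -> dist x <= (c / c2) `^ k^-1 -> V x <= c.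
Proof.
move=> c0 Cx_x dist_le; have [_ V_le] := V_bounds Cx_x; apply: le_trans V_le _.
rewrite mulrC -ler_pdivlMr // -[leRHS](powRVK k0); last by rewrite divr_ge0 // ltW.
by apply: ge0_ler_powR; rewrite ?nnegrE ?(ltW k0) ?powR_ge0 ?distA_ge0.
Qed.

End ClosedLoopStability.

Theorem theorem2 (R : realType) (n m q : nat) (ns : 'I_q -> nat)
    (A : 'M[R]_n) (B : 'M[R]_(n, m)) (K : 'M[R]_(m, n)) (ub : 'cV[R]_m)
    (T1 T2 : 'I_q -> R)
    (V : 'cV[R]_(n + n + q) -> R) (k c1 c2 c3 : R) (U : set 'cV[R]_(n + n)) :
  (1 <= n)%N -> (1 <= m)%N -> (1 <= q)%N -> (q <= n)%N ->
  (forall i, (1 <= ns i)%N) -> (\sum_(i < q) ns i)%N = n ->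
  (forall i, 0 < ub i 0) ->
  (forall i, 0 < T1 i) -> (forall i, T1 i <= T2 i) ->
  C1 V -> 0 < k -> 0 < c1 -> 0 < c2 -> 0 < c3 ->
  nbhs (0 : 'cV[R]_(n + n)) U ->
  (forall x, @Ccl R n q T2 x ->
     c1 * distA T2 x `^ k <= V x /\ V x <= c2 * distA T2 x `^ k) ->
  (forall x, U (xbar x) -> Tset T2 (tau x) ->
     'd V x (fcl A B K ub x) <= - c3 * V x) ->
  (forall x g, @Dcl R n q T2 x -> Gcl ns T1 T2 x g -> V g - V x <= 0) ->
  exp_stable (@Ccl R n q T2) (fcl A B K ub) (@Dcl R n q T2) (Gcl ns T1 T2)
             (distA T2)
  /\
  (forall c : R,
     [set x | @Ccl R n q T2 x /\ V x <= c]
       `<=` [set x | U (xbar x) /\ Tset T2 (tau x)] ->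
     [set x | @Ccl R n q T2 x /\ V x <= c]
       `<=` basin (@Ccl R n q T2) (fcl A B K ub) (@Dcl R n q T2)
                  (Gcl ns T1 T2) (distA T2)).
Proof.
move=> _ _ _ _ _ _ ub0 T10 T12 VC1 k0 c10 c20 c30 nbhsU V_bounds V_flow V_jump.
have T20 i : 0 <= T2 i by exact: le_trans (ltW (T10 i)) (T12 i).
have [kappa [lambda [kappa0 lambda0 decay]]] := sublevel_exp_decay
  ub0 T10 T12 VC1 k0 c10 c20 c30 nbhsU V_bounds V_flow V_jump.
split=> [|c sub x [Cx_x Vx]]; last first.
  apply: (exp_decay_basin kappa0 lambda0) => [|dom phi maxi phi0].
    exact: distA_ge0.
  by apply: (decay c) => //; rewrite phi0.
have [c c0 sub] := exists_sublevel_sub T10 T12 k0 c10 nbhsU V_bounds.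
exists kappa, lambda, ((c / c2) `^ k^-1); split=> // [|dom phi maxi dist_le].
  by rewrite powR_gt0 // divr_gt0.
apply: (decay c sub dom phi maxi).
apply: (V_le_of_distA_le T10 T12 k0 c20 V_bounds c0 _ dist_le).
by have [[_ d00 _] _ _ _] := maxi.1; exact: (solution_in_Ccl T10 maxi.1).
Qed.
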